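(* Let $n,m_1,m_2\ge 2$, let $A,B\in GL_n(k)$ be such that $B^tA^tBA=\lambda I_n$ for some $\lambda\in k^*$, and let $C_1,D_1\in GL_{m_1}(k)$, $C_2,D_2\in GL_{m_2}(k)$ be such that the algebras $\mathcal{G}(A,B|C_1,D_1)$ and $\mathcal{G}(A,B|C_2,D_2)$ are (left) $\mathcal{G}(A,B)$-Galois objects. Then $\mathcal{G}(A,B|C_1,D_1)$ and $\mathcal{G}(A,B|C_2,D_2)$ are isomorphic as Galois objects if and only if $m_1=m_2=:m$ and there exists an invertible matrix $M\in GL_m(k)$ such that $$(C_2,D_2)=((M^{-1})^tC_1M^{-1},\ MD_1M^t).$$
   Context: $k$ is an algebraically closed field; $M^t$ is the transpose of $M$. For $n,m\ge 2$, $A,B\in GL_n(k)$, $C,D\in GL_m(k)$, $\mathcal{G}(A,B|C,D)$ is the universal $k$-algebra with generators $d,d^{-1},x_{ij}$ ($1\le i\le n$, $1\le j\le m$) and relations (with $x=(x_{ij})$) $$x^tAx=Cd,\qquad xDx^t=Bd,\qquad dd^{-1}=1=d^{-1}d.$$ $\mathcal{G}(A,B):=\mathcal{G}(A,B|A,B)$ is a Hopf algebra with $\Delta(x_{ij})=\sum_{l} x_{il}\otimes x_{lj}$, $\Delta(d^{\pm1})=d^{\pm1}\otimes d^{\pm1}$, $\varepsilon(x_{ij})=\delta_{ij}$, $\varepsilon(d^{\pm1})=1$, $S(x)=d^{-1}A^{-1}x^tA$, $S(d^{\pm1})=d^{\mp1}$. The algebra $\mathcal{G}(A,B|C,D)$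 is a left $\mathcal{G}(A,B)$-comodule algebra through the algebra map $\mathcal{G}(A,B|C,D)\to\mathcal{G}(A,B)\otimes\mathcal{G}(A,B|C,D)$, $x_{ij}\mapsto\sum_{l=1}^n x_{il}\otimes x_{lj}$, $d^{\pm1}\mapsto d^{\pm1}\otimes d^{\pm1}$. A left $H$-Galois object is a nonzero left $H$-comodule algebra $Z$ with coaction $z\mapsto z_{(-1)}\otimes z_{(0)}$ such that the canonical map $Z\otimes Z\to H\otimes Z$, $z\otimes z'\mapsto z_{(-1)}\otimes z_{(0)}z'$, is bijective. Isomorphisms of Galois objects are $H$-colinear algebra isomorphisms. *)

(* Defs.v *)
From HB Require Import structures.
From mathcomp Require Import all_boot all_order all_algebra.
From mathcomp Require Import generic_quotient boolp.

Set Implicit Arguments.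
Unset Strict Implicit.
Unset Printing Implicit Defensive.

Import GRing.Theory.
Local Open Scope ring_scope.
Local Open Scope quotient_scope.

(* Unital associative k-algebras. The library's algType is nontrivial by
   definition (1 != 0), whereas an algebra given by generators and relations may
   be zero; hence this variant, in which 1 = 0 is allowed. *)
Record kalg (k : fieldType) := KAlg {
  kalg_lmod : lmodType k;
  kalg_one : kalg_lmod;
  kalg_mul : kalg_lmod -> kalg_lmod -> kalg_lmod;
  kalg_mulA : associative kalg_mul;
  kalg_mul1l : left_id kalg_one kalg_mul;
  kalg_mul1r : right_id kalg_one kalg_mul;
  kalg_mulDl : left_distributive kalg_mul +%R;
  kalg_mulDr : right_distributive kalg_mul +%R;
  kalg_scaleAl : forall (c : k) a b,
    c *: kalg_mul a b = kalg_mul (c *: a) b;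
  kalg_scaleAr : forall (c : k) a b,
    c *: kalg_mul a b = kalg_mul a (c *: b)
}.

Definition kalg_sort (k : fieldType) (A : kalg k) : Type := kalg_lmod A.
Coercion kalg_sort : kalg >-> Sortclass.

HB.instance Definition _ (k : fieldType) (A : kalg k) :=
  GRing.Lmodule.copy (kalg_sort A) (kalg_lmod A).
HB.instance Definition _ (k : fieldType) (A : kalg k) :=
  GRing.Zmodule_isPzRing.Build (kalg_sort A) (@kalg_mulA k A)
    (@kalg_mul1l k A) (@kalg_mul1r k A) (@kalg_mulDl k A) (@kalg_mulDr k A).

Lemma kscalerAl (k : fieldType) (A : kalg k) (c : k) (a b : A) :
  c *: (a * b) = (c *: a) * b.
Proof. exact: (@kalg_scaleAl k A). Qed.
Lemma kscalerAr (k : fieldType) (A : kalg k) (c : k) (a b : A) :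
  c *: (a * b) = a * (c *: b).
Proof. exact: (@kalg_scaleAr k A). Qed.

Definition kalg_module (k : fieldType) (A : kalg k) : lmodType k := kalg_sort A.
Coercion kalg_module : kalg >-> GRing.Lmodule.type.

Definition alg_morphism (k : fieldType) (A B : kalg k) (f : A -> B) : Prop :=
  linear f /\ (f 1 = 1 /\ {morph f : a b / a * b}).

Definition ground_alg (k : fieldType) : kalg k :=
  @KAlg k k^o 1 *%R (@mulrA k) (@mul1r k) (@mulr1 k) (@mulrDl k) (@mulrDr k)
    (fun c a b => mulrA c a b) (fun c a b => mulrCA c a b).

Section LinearFacts.
Variables (k : fieldType) (U V : lmodType k) (f : U -> V).
Hypothesis fl : linear f.
Lemma lin0 : f 0 = 0.
Proof. by have := fl (-1) 0 0; rewrite scaler0 addr0 scaleN1r addNr. Qed.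
Lemma linD a b : f (a + b) = f a + f b.
Proof. by rewrite -[a in LHS]scale1r fl scale1r. Qed.
Lemma linZ c a : f (c *: a) = c *: f a.
Proof. by rewrite -[c *: a in LHS]addr0 fl lin0 addr0. Qed.
Lemma lin_sum (I : Type) (r : seq I) (P : pred I) (F : I -> U) :
  f (\sum_(i <- r | P i) F i) = \sum_(i <- r | P i) f (F i).
Proof. by elim/big_rec2: _ => [|i y1 y2 _ <-]; rewrite ?lin0 ?linD. Qed.
End LinearFacts.

(* The universal algebra on generators X with relations R is the quotient of
   formal expressions by the least congruence containing the axioms of
   k-algebras and R; the opposite of s is (-1) s. *)
Section PresentedAlgebra.
Variables (k : fieldType) (X : Type).

Inductive algterm : Type :=
| AZero | AOne | AGen of X | AScale of k & algterm
| AAdd of algterm & algterm | AMul of algterm & algterm.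

Inductive algeq (R : algterm -> algterm -> Prop) : algterm -> algterm -> Prop :=
| aeq_rel s t : R s t -> algeq R s t
| aeq_refl s : algeq R s s
| aeq_sym s t : algeq R s t -> algeq R t s
| aeq_trans s t u : algeq R s t -> algeq R t u -> algeq R s u
| aeq_scale c s s' : algeq R s s' -> algeq R (AScale c s) (AScale c s')
| aeq_add s s' t t' :
    algeq R s s' -> algeq R t t' -> algeq R (AAdd s t) (AAdd s' t')
| aeq_mul s s' t t' :
    algeq R s s' -> algeq R t t' -> algeq R (AMul s t) (AMul s' t')
| aeq_addA s t u : algeq R (AAdd s (AAdd t u)) (AAdd (AAdd s t) u)
| aeq_addC s t : algeq R (AAdd s t) (AAdd t s)
| aeq_add0 s : algeq R (AAdd AZero s) s
| aeq_addN s : algeq R (AAdd (AScale (-1) s) s) AZero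
| aeq_scaleA a b s : algeq R (AScale a (AScale b s)) (AScale (a * b) s)
| aeq_scale1 s : algeq R (AScale 1 s) s
| aeq_scaleDr c s t :
    algeq R (AScale c (AAdd s t)) (AAdd (AScale c s) (AScale c t))
| aeq_scaleDl a b s :
    algeq R (AScale (a + b) s) (AAdd (AScale a s) (AScale b s))
| aeq_mulA s t u : algeq R (AMul s (AMul t u)) (AMul (AMul s t) u)
| aeq_mul1l s : algeq R (AMul AOne s) s
| aeq_mul1r s : algeq R (AMul s AOne) s
| aeq_mulDl s t u :
    algeq R (AMul (AAdd s t) u) (AAdd (AMul s u) (AMul t u))
| aeq_mulDr s t u :
    algeq R (AMul s (AAdd t u)) (AAdd (AMul s t) (AMul s u))
| aeq_scaleAl c s t : algeq R (AScale c (AMul s t)) (AMul (AScale c s) t)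
| aeq_scaleAr c s t : algeq R (AScale c (AMul s t)) (AMul s (AScale c t)).

HB.instance Definition _ := gen_eqMixin algterm.
HB.instance Definition _ := gen_choiceMixin algterm.

Variable R : algterm -> algterm -> Prop.

Definition algeqb (s t : algterm) : bool := `[< algeq R s t >].

Lemma algeqb_equiv : equiv_class_of algeqb.
Proof.
split=> [s|s t|t s u].
- by apply/asboolP; apply: aeq_refl.
- by apply/asboolP/asboolP; apply: aeq_sym.
- by move=> /asboolP H1 /asboolP H2; apply/asboolP; apply: aeq_trans H1 H2.
Qed.

Canonical algeqb_rel := EquivRelPack algeqb_equiv.

Definition presMod : Type := {eq_quot algeqb_rel}.

HB.instance Definition _ := Choice.copy presMod {eq_quot algeqb_rel}.

Definition pcls (s : algterm) : presMod := \pi_({eq_quot algeqb_rel}) s.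
Definition prepr (a : presMod) : algterm := repr (a : {eq_quot algeqb_rel}).

Lemma preprK : cancel prepr pcls.
Proof. by move=> a; rewrite /pcls /prepr reprK. Qed.

Lemma presW (P : presMod -> Prop) : (forall s, P (pcls s)) -> forall a, P a.
Proof. by move=> H a; rewrite -[a]preprK; apply: H. Qed.

Lemma presP (s t : algterm) : (pcls s = pcls t) <-> algeq R s t.
Proof.
split=> [/eqmodP/asboolP //|H].
by apply/eqmodP; apply/asboolP.
Qed.

Lemma algeq_repr (s : algterm) : algeq R (prepr (pcls s)) s.
Proof. by apply/presP; rewrite preprK. Qed.

Definition pzero : presMod := pcls AZero.
Definition pone : presMod := pcls AOne.
Definition padd (a b : presMod) : presMod := pcls (AAdd (prepr a) (prepr b)).
Definition pmul (a b : presMod) : presMod := pcls (AMul (prepr a) (prepr b)).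
Definition pscale (c : k) (a : presMod) : presMod := pcls (AScale c (prepr a)).
Definition popp (a : presMod) : presMod := pscale (-1) a.

Lemma paddE s t : padd (pcls s) (pcls t) = pcls (AAdd s t).
Proof. by apply/presP; apply: aeq_add; apply: algeq_repr. Qed.
Lemma pmulE s t : pmul (pcls s) (pcls t) = pcls (AMul s t).
Proof. by apply/presP; apply: aeq_mul; apply: algeq_repr. Qed.
Lemma pscaleE c s : pscale c (pcls s) = pcls (AScale c s).
Proof. by apply/presP; apply: aeq_scale; apply: algeq_repr. Qed.

Let pE := (paddE, pmulE, pscaleE).

Lemma paddA : associative padd.
Proof. by elim/presW=> s; elim/presW=> t; elim/presW=> u; rewrite !pE; apply/presP; apply: aeq_addA. Qed.
Lemma paddC : commutative padd.
Proof. by elim/presW=> s; elim/presW=> t; rewrite !pE; apply/presP; apply: aeq_addC. Qed.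
Lemma padd0 : left_id pzero padd.
Proof. by elim/presW=> s; rewrite !pE; apply/presP; apply: aeq_add0. Qed.
Lemma paddN : left_inverse pzero popp padd.
Proof. by elim/presW=> s; rewrite /popp !pE; apply/presP; apply: aeq_addN. Qed.

HB.instance Definition _ := GRing.isZmodule.Build presMod paddA paddC padd0 paddN.

Lemma pmulA : associative pmul.
Proof. by elim/presW=> s; elim/presW=> t; elim/presW=> u; rewrite !pE; apply/presP; apply: aeq_mulA. Qed.
Lemma pmul1l : left_id pone pmul.
Proof. by elim/presW=> s; rewrite !pE; apply/presP; apply: aeq_mul1l. Qed.
Lemma pmul1r : right_id pone pmul.
Proof. by elim/presW=> s; rewrite !pE; apply/presP; apply: aeq_mul1r. Qed.
Lemma pmulDl : left_distributive pmul +%R.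
Proof.
elim/presW=> s; elim/presW=> t; elim/presW=> u.
by rewrite -[+%R]/padd !pE; apply/presP; apply: aeq_mulDl.
Qed.
Lemma pmulDr : right_distributive pmul +%R.
Proof.
elim/presW=> s; elim/presW=> t; elim/presW=> u.
by rewrite -[+%R]/padd !pE; apply/presP; apply: aeq_mulDr.
Qed.

Lemma pscaleA a b v : pscale a (pscale b v) = pscale (a * b) v.
Proof. by move: v; elim/presW=> s; rewrite !pE; apply/presP; apply: aeq_scaleA. Qed.
Lemma pscale1 : left_id 1 pscale.
Proof. by elim/presW=> s; rewrite !pE; apply/presP; apply: aeq_scale1. Qed.
Lemma pscaleDr : right_distributive pscale +%R.
Proof.
move=> c; elim/presW=> s; elim/presW=> t.
by rewrite -[+%R]/padd !pE; apply/presP; apply: aeq_scaleDr.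
Qed.
Lemma pscaleDl v : {morph pscale^~ v : a b / a + b}.
Proof.
move=> a b; move: v; elim/presW=> s.
by rewrite -[X in _ = X]/(padd _ _) !pE; apply/presP; apply: aeq_scaleDl.
Qed.

HB.instance Definition _ :=
  GRing.Zmodule_isLmodule.Build k presMod pscaleA pscale1 pscaleDr pscaleDl.

Lemma pscaleAl (c : k) (a b : presMod) : c *: pmul a b = pmul (c *: a) b.
Proof.
move: a b; elim/presW=> s; elim/presW=> t.
by rewrite -[*:%R]/pscale !pE; apply/presP; apply: aeq_scaleAl.
Qed.
Lemma pscaleAr (c : k) (a b : presMod) : c *: pmul a b = pmul a (c *: b).
Proof.
move: a b; elim/presW=> s; elim/presW=> t.
by rewrite -[*:%R]/pscale !pE; apply/presP; apply: aeq_scaleAr.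
Qed.

Definition presAlg : kalg k :=
  KAlg pmulA pmul1l pmul1r pmulDl pmulDr pscaleAl pscaleAr.

Definition pgen (x : X) : presAlg := pcls (AGen x).

Fixpoint aeval (A : kalg k) (g : X -> A) (t : algterm) : A :=
  match t with
  | AZero => 0
  | AOne => 1
  | AGen x => g x
  | AScale c s => c *: aeval g s
  | AAdd s u => aeval g s + aeval g u
  | AMul s u => aeval g s * aeval g u
  end.

Lemma aeval_pi s : aeval pgen s = pcls s.
Proof.
elim: s => //= [c s ->|s -> t ->|s -> t ->].
- by rewrite -[*:%R]/pscale pE.
- by rewrite -[+%R]/padd pE.
- by rewrite -[*%R]/pmul pE.
Qed.

Lemma pres_rel s t : R s t -> aeval pgen s = aeval pgen t.
Proof. by move=> h; rewrite !aeval_pi; apply/presP; apply: aeq_rel. Qed.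

Definition pres_lift (A : kalg k) (g : X -> A) (a : presAlg) : A :=
  aeval g (prepr (a : presMod)).

Section Lift.
Variables (A : kalg k) (g : X -> A).
Hypothesis gR : forall s t, R s t -> aeval g s = aeval g t.

Lemma aeval_eq s t : algeq R s t -> aeval g s = aeval g t.
Proof.
elim=> //= {s t}.
- by move=> s t u _ -> _ ->.
- by move=> c s s' _ ->.
- by move=> s s' t t' _ -> _ ->.
- by move=> s s' t t' _ -> _ ->.
- by move=> s t u; rewrite addrA.
- by move=> s t; rewrite addrC.
- by move=> s; rewrite add0r.
- by move=> s; rewrite scaleN1r addNr.
- by move=> a b s; rewrite scalerA.
- by move=> s; rewrite scale1r.
- by move=> c s t; rewrite scalerDr.
- by move=> a b s; rewrite scalerDl.
- by move=> s t u; rewrite mulrA.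
- by move=> s; rewrite mul1r.
- by move=> s; rewrite mulr1.
- by move=> s t u; rewrite mulrDl.
- by move=> s t u; rewrite mulrDr.
- by move=> c s t; rewrite kscalerAl.
- by move=> c s t; rewrite kscalerAr.
Qed.

Lemma pres_lift_pi s : pres_lift g (pcls s) = aeval g s.
Proof. by apply: aeval_eq; apply: algeq_repr. Qed.

Lemma pres_lift_gen x : pres_lift g (pgen x) = g x.
Proof. by rewrite pres_lift_pi. Qed.

Lemma pres_lift_morphism : alg_morphism (pres_lift g).
Proof.
split.
  move=> c; elim/presW=> s; elim/presW=> t.
  by rewrite -[*:%R in LHS]/pscale -[+%R in LHS]/padd !pE !pres_lift_pi.
split; first by rewrite -[1 in LHS]/pone pres_lift_pi.
elim/presW=> s; elim/presW=> t.
by rewrite -[*%R in LHS]/pmul !pE !pres_lift_pi.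
Qed.
End Lift.

Lemma pres_ext (A : kalg k) (f g : presAlg -> A) :
  alg_morphism f -> alg_morphism g ->
  (forall x, f (pgen x) = g (pgen x)) -> f =1 g.
Proof.
move=> [fl [f1 fM]] [gl [g1 gM]] fg; elim/presW=> s; rewrite -aeval_pi.
elim: s => //= [||c s IH|s IHs t IHt|s IHs t IHt].
- by rewrite !lin0.
- by rewrite f1 g1.
- by rewrite !linZ // IH.
- by rewrite !linD // IHs IHt.
- by rewrite fM gM IHs IHt.
Qed.

End PresentedAlgebra.

Arguments AZero {k X}.
Arguments AOne {k X}.
Arguments AGen {k X} _.

(* The tensor product over k, likewise: formal combinations of symbols u (x) v
   modulo the axioms of k-modules and bilinearity. *)
Section Tensor.
Variables (k : fieldType) (U V : lmodType k).

Inductive tterm : Type :=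
| TZero | TPure of U & V | TScale of k & tterm | TAdd of tterm & tterm.

Inductive teq : tterm -> tterm -> Prop :=
| teq_refl s : teq s s
| teq_sym s t : teq s t -> teq t s
| teq_trans s t u : teq s t -> teq t u -> teq s u
| teq_scale c s s' : teq s s' -> teq (TScale c s) (TScale c s')
| teq_add s s' t t' : teq s s' -> teq t t' -> teq (TAdd s t) (TAdd s' t')
| teq_addA s t u : teq (TAdd s (TAdd t u)) (TAdd (TAdd s t) u)
| teq_addC s t : teq (TAdd s t) (TAdd t s)
| teq_add0 s : teq (TAdd TZero s) s
| teq_addN s : teq (TAdd (TScale (-1) s) s) TZero
| teq_scaleA a b s : teq (TScale a (TScale b s)) (TScale (a * b) s)
| teq_scale1 s : teq (TScale 1 s) s
| teq_scaleDr c s t :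
    teq (TScale c (TAdd s t)) (TAdd (TScale c s) (TScale c t))
| teq_scaleDl a b s :
    teq (TScale (a + b) s) (TAdd (TScale a s) (TScale b s))
| teq_linl c u u' v :
    teq (TPure (c *: u + u') v) (TAdd (TScale c (TPure u v)) (TPure u' v))
| teq_linr c u v v' :
    teq (TPure u (c *: v + v')) (TAdd (TScale c (TPure u v)) (TPure u v')).

HB.instance Definition _ := gen_eqMixin tterm.
HB.instance Definition _ := gen_choiceMixin tterm.

Definition teqb (s t : tterm) : bool := `[< teq s t >].

Lemma teqb_equiv : equiv_class_of teqb.
Proof.
split=> [s|s t|t s u].
- by apply/asboolP; apply: teq_refl.
- by apply/asboolP/asboolP; apply: teq_sym.
- by move=> /asboolP H1 /asboolP H2; apply/asboolP; apply: teq_trans H1 H2.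
Qed.

Canonical teqb_rel := EquivRelPack teqb_equiv.

Definition tens : Type := {eq_quot teqb_rel}.

HB.instance Definition _ := Choice.copy tens {eq_quot teqb_rel}.

Definition tcls (s : tterm) : tens := \pi_({eq_quot teqb_rel}) s.
Definition trepr (a : tens) : tterm := repr (a : {eq_quot teqb_rel}).

Lemma treprK : cancel trepr tcls.
Proof. by move=> a; rewrite /tcls /trepr reprK. Qed.

Lemma tensW (P : tens -> Prop) : (forall s, P (tcls s)) -> forall a, P a.
Proof. by move=> H a; rewrite -[a]treprK; apply: H. Qed.

Lemma tensP (s t : tterm) : (tcls s = tcls t) <-> teq s t.
Proof.
split=> [/eqmodP/asboolP //|H].
by apply/eqmodP; apply/asboolP.
Qed.

Lemma teq_repr (s : tterm) : teq (trepr (tcls s)) s.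
Proof. by apply/tensP; rewrite treprK. Qed.

Definition tzero : tens := tcls TZero.
Definition tadd (a b : tens) : tens := tcls (TAdd (trepr a) (trepr b)).
Definition tscale (c : k) (a : tens) : tens := tcls (TScale c (trepr a)).
Definition topp (a : tens) : tens := tscale (-1) a.

Lemma taddE s t : tadd (tcls s) (tcls t) = tcls (TAdd s t).
Proof. by apply/tensP; apply: teq_add; apply: teq_repr. Qed.
Lemma tscaleE c s : tscale c (tcls s) = tcls (TScale c s).
Proof. by apply/tensP; apply: teq_scale; apply: teq_repr. Qed.

Let tE := (taddE, tscaleE).

Lemma taddA : associative tadd.
Proof.
elim/tensW=> s; elim/tensW=> t; elim/tensW=> u.
by rewrite !tE; apply/tensP; apply: teq_addA.
Qed.
Lemma taddC : commutative tadd.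
Proof.
by elim/tensW=> s; elim/tensW=> t; rewrite !tE; apply/tensP; apply: teq_addC.
Qed.
Lemma tadd0 : left_id tzero tadd.
Proof. by elim/tensW=> s; rewrite !tE; apply/tensP; apply: teq_add0. Qed.
Lemma taddN : left_inverse tzero topp tadd.
Proof.
by elim/tensW=> s; rewrite /topp !tE; apply/tensP; apply: teq_addN.
Qed.

HB.instance Definition _ := GRing.isZmodule.Build tens taddA taddC tadd0 taddN.

Lemma tscaleA a b v : tscale a (tscale b v) = tscale (a * b) v.
Proof.
by move: v; elim/tensW=> s; rewrite !tE; apply/tensP; apply: teq_scaleA.
Qed.
Lemma tscale1 : left_id 1 tscale.
Proof. by elim/tensW=> s; rewrite !tE; apply/tensP; apply: teq_scale1. Qed.
Lemma tscaleDr : right_distributive tscale +%R.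
Proof.
move=> c; elim/tensW=> s; elim/tensW=> t.
by rewrite -[+%R]/tadd !tE; apply/tensP; apply: teq_scaleDr.
Qed.
Lemma tscaleDl v : {morph tscale^~ v : a b / a + b}.
Proof.
move=> a b; move: v; elim/tensW=> s.
by rewrite -[X in _ = X]/(tadd _ _) !tE; apply/tensP; apply: teq_scaleDl.
Qed.

HB.instance Definition _ :=
  GRing.Zmodule_isLmodule.Build k tens tscaleA tscale1 tscaleDr tscaleDl.

Definition pure (u : U) (v : V) : tens := tcls (TPure u v).

Lemma pure_linl v : linear (pure^~ v).
Proof.
move=> c u u'; rewrite -[*:%R in RHS]/tscale -[+%R in RHS]/tadd /pure !tE.
by apply/tensP; apply: teq_linl.
Qed.
Lemma pure_linr u : linear (pure u).
Proof.
move=> c v v'; rewrite -[*:%R in RHS]/tscale -[+%R in RHS]/tadd /pure !tE.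
by apply/tensP; apply: teq_linr.
Qed.

Lemma tens_ind (P : tens -> Prop) : (forall u v, P (pure u v)) ->
  (forall c s t, P s -> P t -> P (c *: s + t)) -> forall t, P t.
Proof.
move=> Pp PD.
have P0 : P 0 by have := PD (-1) _ _ (Pp 0 0) (Pp 0 0); rewrite scaleN1r addNr.
elim/tensW; elim=> [|u v|c s IH|s IHs t IHt].
- exact: P0.
- exact: Pp.
- by have := PD c _ _ IH P0; rewrite addr0 -[*:%R]/tscale tE.
- by have := PD 1 _ _ IHs IHt; rewrite scale1r -[+%R]/tadd tE.
Qed.

Section Lift.
Variable W : lmodType k.
Implicit Type f : U -> V -> W.

Definition bilin f : Prop :=
  (forall v, linear (f^~ v)) /\ (forall u, linear (f u)).

Fixpoint teval f (t : tterm) : W :=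
  match t with
  | TZero => 0
  | TPure u v => f u v
  | TScale c s => c *: teval f s
  | TAdd s t => teval f s + teval f t
  end.

(* The linear map with u (x) v |-> f u v; meaningful for bilinear f. *)
Definition tlift f (t : tens) : W := teval f (trepr t).

Lemma teval_eq f s t : bilin f -> teq s t -> teval f s = teval f t.
Proof.
move=> [fl fr]; elim=> //= {s t}.
- by move=> s t u _ -> _ ->.
- by move=> c s s' _ ->.
- by move=> s s' t t' _ -> _ ->.
- by move=> s t u; rewrite addrA.
- by move=> s t; rewrite addrC.
- by move=> s; rewrite add0r.
- by move=> s; rewrite scaleN1r addNr.
- by move=> a b s; rewrite scalerA.
- by move=> s; rewrite scale1r.
- by move=> c s t; rewrite scalerDr.
- by move=> a b s; rewrite scalerDl.
- by move=> c u u' v; rewrite [LHS]fl.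
- by move=> c u v v'; rewrite [LHS]fr.
Qed.

Lemma tlift_cls f s : bilin f -> tlift f (tcls s) = teval f s.
Proof. by move=> bf; apply: teval_eq bf (teq_repr _). Qed.

Lemma tlift_pure f u v : bilin f -> tlift f (pure u v) = f u v.
Proof. by move=> bf; rewrite tlift_cls. Qed.

Lemma tlift_linear f : bilin f -> linear (tlift f).
Proof.
move=> bf c; elim/tensW=> s; elim/tensW=> t.
by rewrite -[*:%R in LHS]/tscale -[+%R in LHS]/tadd !tE !tlift_cls.
Qed.

Lemma tlift_linf f g h c t : bilin f -> bilin g -> bilin h ->
  (forall u v, h u v = c *: f u v + g u v) ->
  tlift h t = c *: tlift f t + tlift g t.
Proof.
move=> bf bg bh E; elim/tens_ind: t => [u v|b s t IHs IHt].
  by rewrite !tlift_pure.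
rewrite !tlift_linear // IHs IHt !scalerDr !scalerA mulrC -!addrA; congr (_ + _).
by rewrite addrCA.
Qed.

End Lift.

End Tensor.

Arguments tlift {k U V W} f t.
Arguments pure {k U V} u v.

Section TensorMap.
Variables (k : fieldType).

Definition tmap (U V U' V' : lmodType k) (f : U -> U') (g : V -> V') :
    tens U V -> tens U' V' :=
  tlift (fun u v => pure (f u) (g v)).

Definition tassoc (U V W : lmodType k) :
    tens (tens U V) W -> tens U (tens V W) :=
  tlift (fun s w => tlift (fun u v => pure u (pure v w)) s).

Lemma tmap_bilin (U V U' V' : lmodType k) (f : U -> U') (g : V -> V') :
  linear f -> linear g -> bilin (fun u v => pure (f u) (g v)).
Proof.
move=> fl gl; split=> [v|u] c x y /=; first by rewrite fl pure_linl.
by rewrite gl pure_linr.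
Qed.

Lemma tmap_pure (U V U' V' : lmodType k) (f : U -> U') (g : V -> V') u v :
  linear f -> linear g -> tmap f g (pure u v) = pure (f u) (g v).
Proof. by move=> fl gl; rewrite /tmap tlift_pure //; apply: tmap_bilin. Qed.

Lemma tmap_linear (U V U' V' : lmodType k) (f : U -> U') (g : V -> V') :
  linear f -> linear g -> linear (tmap f g).
Proof. by move=> fl gl; apply/tlift_linear/tmap_bilin. Qed.

Lemma tassoc_bilin1 (U V W : lmodType k) (w : W) :
  bilin (fun (u : U) (v : V) => pure u (pure v w)).
Proof.
split=> [v|u] c x y /=; first by rewrite pure_linl.
by rewrite pure_linl pure_linr.
Qed.

Lemma tassoc_bilin (U V W : lmodType k) :
  bilin (fun (s : tens U V) (w : W) => tlift (fun u v => pure u (pure v w)) s).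
Proof.
split=> [w|s] c x y; first by apply/tlift_linear/tassoc_bilin1.
apply: tlift_linf; try exact: tassoc_bilin1.
by move=> u v; rewrite !pure_linr.
Qed.

Lemma tassoc_pure (U V W : lmodType k) (u : U) (v : V) (w : W) :
  tassoc (pure (pure u v) w) = pure u (pure v w).
Proof.
rewrite /tassoc tlift_pure; last exact: tassoc_bilin.
by rewrite tlift_pure //; apply: tassoc_bilin1.
Qed.

Lemma tassoc_linear (U V W : lmodType k) : linear (@tassoc U V W).
Proof. by apply/tlift_linear/tassoc_bilin. Qed.
End TensorMap.

Lemma kmul_linl (k : fieldType) (A : kalg k) (b : A) : linear (fun a : A => a * b).
Proof. by move=> c x y; rewrite mulrDl kscalerAl. Qed.
Lemma kmul_linr (k : fieldType) (A : kalg k) (a : A) : linear (fun b : A => a * b).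
Proof. by move=> c x y; rewrite mulrDr kscalerAr. Qed.

Section TensorAlgebra.
Variables (k : fieldType) (A B : kalg k).

Definition tmul (s t : tens A B) : tens A B :=
  tlift (fun (a : A) (b : B) =>
    tlift (fun (c : A) (d : B) => pure (a * c : A) (b * d : B)) t) s.
Definition tone : tens A B := pure (1 : A) (1 : B).

Lemma tmul_bilin1 (a : A) (b : B) :
  bilin (fun (c : A) (d : B) => pure (a * c : A) (b * d : B)).
Proof. by apply: tmap_bilin; apply: kmul_linr. Qed.

Lemma tmul_bilin t : bilin (fun (a : A) (b : B) =>
    tlift (fun (c : A) (d : B) => pure (a * c : A) (b * d : B)) t).
Proof.
split=> [b|a] c x y; apply: tlift_linf; try exact: tmul_bilin1; move=> a' b'.
  by rewrite kmul_linl pure_linl.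
by rewrite kmul_linl pure_linr.
Qed.

Lemma tmul_pure (a c : A) (b d : B) :
  tmul (pure a b) (pure c d) = pure (a * c : A) (b * d : B).
Proof.
rewrite /tmul tlift_pure; last exact: tmul_bilin.
by rewrite tlift_pure //; apply: tmul_bilin1.
Qed.

Lemma tmul_linl t : linear (tmul^~ t).
Proof. by apply/tlift_linear/tmul_bilin. Qed.
Lemma tmul_linr s : linear (tmul s).
Proof.
move=> c x y; elim/tens_ind: s => [a b|c' s t IHs IHt].
  rewrite /tmul !(tlift_pure _ _ (tmul_bilin _)).
  by rewrite tlift_linear //; apply: tmul_bilin1.
rewrite !tmul_linl IHs IHt !scalerDr !scalerA mulrC -!addrA; congr (_ + _).
by rewrite addrCA.
Qed.

Lemma tmulA : associative tmul.
Proof.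
move=> s t u.
elim/tens_ind: s => [a b|c s s' IH IH']; last by rewrite !tmul_linl IH IH'.
elim/tens_ind: t => [a' b'|c t t' IH IH'].
  elim/tens_ind: u => [a2 b2|c u u' IH IH']; last by rewrite !tmul_linr IH IH'.
  by rewrite !tmul_pure !mulrA.
by rewrite tmul_linl !tmul_linr tmul_linl IH IH'.
Qed.
Lemma tmul1l : left_id tone tmul.
Proof.
elim/tens_ind=> [a b|c s t IHs IHt]; first by rewrite tmul_pure !mul1r.
by rewrite tmul_linr IHs IHt.
Qed.
Lemma tmul1r : right_id tone tmul.
Proof.
elim/tens_ind=> [a b|c s t IHs IHt]; first by rewrite tmul_pure !mulr1.
by rewrite tmul_linl IHs IHt.
Qed.
Lemma tmulDl : left_distributive tmul +%R.
Proof. by move=> s t u; apply: linD (tmul_linl u) _ _. Qed.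
Lemma tmulDr : right_distributive tmul +%R.
Proof. by move=> s t u; apply: linD (tmul_linr s) _ _. Qed.
Lemma tmul_scaleAl (c : k) s t : c *: tmul s t = tmul (c *: s) t.
Proof. by symmetry; apply: linZ (tmul_linl t) _ _. Qed.
Lemma tmul_scaleAr (c : k) s t : c *: tmul s t = tmul s (c *: t).
Proof. by symmetry; apply: linZ (tmul_linr s) _ _. Qed.

Definition tensA : kalg k :=
  KAlg tmulA tmul1l tmul1r tmulDl tmulDr tmul_scaleAl tmul_scaleAr.

Definition tpure (a : A) (b : B) : tensA := pure a b.

Lemma tpureM a b c d : tpure a b * tpure c d = tpure (a * c) (b * d).
Proof. exact: tmul_pure. Qed.
Lemma tpure1 : tpure 1 1 = 1.
Proof. by []. Qed.
End TensorAlgebra.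

Lemma alg_morphism_lin (k : fieldType) (A B : kalg k) (f : A -> B) :
  alg_morphism f -> linear f.
Proof. by case. Qed.

Lemma alg_morphism_id (k : fieldType) (A : kalg k) : alg_morphism (@id A).
Proof. by []. Qed.

Lemma alg_morphism_comp (k : fieldType) (A B C : kalg k)
    (g : B -> C) (f : A -> B) :
  alg_morphism g -> alg_morphism f -> alg_morphism (g \o f).
Proof.
move=> [gl [g1 gM]] [fl [f1 fM]]; split=> [c x y|]; first by rewrite /= fl gl.
by split=> [|x y] /=; rewrite ?f1 ?g1 ?fM ?gM.
Qed.

Lemma tmap_morphism (k : fieldType) (A B A' B' : kalg k)
    (f : A -> A') (g : B -> B') : alg_morphism f -> alg_morphism g ->
  alg_morphism (tmap f g : tensA A B -> tensA A' B').
Proof.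
move=> [fl [f1 fM]] [gl [g1 gM]]; have tl := tmap_linear fl gl.
split=> //; split=> [|s t].
  by rewrite -!tpure1 /tpure /= (tmap_pure _ _ fl gl) f1 g1.
suff H (u v : tens A B) :
    tmap f g (tmul u v) = tmul (tmap f g u : tens A' B') (tmap f g v) by exact: H.
move: u v => {}s {}t.
elim/tens_ind: s => [a b|c s s' IH IH']; last first.
  by rewrite tmul_linl !tl tmul_linl IH IH'.
elim/tens_ind: t => [a' b'|c t t' IH IH']; last first.
  by rewrite tmul_linr !tl tmul_linr IH IH'.
by rewrite tmul_pure !(tmap_pure _ _ fl gl) tmul_pure fM gM.
Qed.

Lemma tassoc_morphism (k : fieldType) (A B C : kalg k) :
  alg_morphism (@tassoc k A B C : tensA (tensA A B) C -> tensA A (tensA B C)).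
Proof.
have tl := @tassoc_linear k A B C; split=> //; split=> [|s t].
  exact: tassoc_pure.
suff H (u v : tens (tensA A B) C) : tassoc (tmul u v : tens (tens A B) C) =
    tmul (tassoc u : tens A (tensA B C)) (tassoc v) by exact: H.
move: u v => {}s {}t.
elim/tens_ind: s => [u c|c s s' IH IH']; last first.
  by rewrite tmul_linl !tl tmul_linl IH IH'.
elim/tens_ind: t => [u' c'|e t t' IH IH']; last first.
  by rewrite tmul_linr !tl tmul_linr IH IH'.
rewrite tmul_pure.
elim/tens_ind: u => [a b|e u v IH IH']; last first.
  by rewrite kmul_linl !pure_linl !tl tmul_linl IH IH'.
elim/tens_ind: u' => [a' b'|e u v IH IH']; last first.
  by rewrite kmul_linr !pure_linl !tl tmul_linr IH IH'.
rewrite -[X in pure X _]/(tmul _ _) tmul_pure !tassoc_pure tmul_pure.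
by rewrite -[X in _ = pure _ X]/(tmul _ _) tmul_pure.
Qed.

Record bialgebra (k : fieldType) := Bialgebra {
  bialg_alg :> kalg k;
  comult : bialg_alg -> tensA bialg_alg bialg_alg;
  counit : bialg_alg -> k;
  comult_morphism : alg_morphism comult;
  counit_morphism : alg_morphism (counit : bialg_alg -> ground_alg k);
  comultA : forall h,
    tassoc (tmap comult id (comult h)) = tmap id comult (comult h);
  counitl : forall h, tlift (fun a b => counit a *: b) (comult h) = h;
  counitr : forall h, tlift (fun a b => counit b *: a) (comult h) = h
}.

Definition is_antipode (k : fieldType) (H : bialgebra k) (S : H -> H) : Prop :=
  linear S /\
  forall h : H,
    tlift (fun a b : H => S a * b) (comult h) = counit h *: (1 : H) /\
    tlift (fun a b : H => a * S b) (comult h) = counit h *: (1 : H).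

Record comodAlg (k : fieldType) (H : bialgebra k) := ComodAlg {
  comod_alg :> kalg k;
  coaction : comod_alg -> tensA H comod_alg;
  coaction_morphism : alg_morphism coaction;
  coactionA : forall z,
    tassoc (tmap (@comult k H) id (coaction z)) = tmap id coaction (coaction z);
  coaction_counit : forall z,
    tlift (fun (h : H) (y : comod_alg) => counit h *: y) (coaction z) = z
}.

(* The antipode of a Hopf algebra H plays no role in the definition of its
   Galois objects, so these are defined over any bialgebra. *)
Section Galois.
Variables (k : fieldType) (H : bialgebra k).

(* z (x) z' |-> z_(-1) (x) z_(0) z' *)
Definition galois_map (Z : comodAlg H) : tens Z Z -> tens H Z :=
  tlift (fun z z' : Z =>
    tlift (fun (h : H) (y : Z) => pure h (y * z')) (coaction z)).

Definition is_galois (Z : comodAlg H) : Prop :=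
  (1 : Z) <> 0 /\ bijective (galois_map (Z := Z)).

Definition galois_iso (Z Z' : comodAlg H) : Prop :=
  exists f : Z -> Z', [/\ alg_morphism f, bijective f &
    forall z, coaction (f z) = tmap id f (coaction z)].

Lemma galois_map_pure (Z : comodAlg H) (z z' : Z) :
  galois_map (pure z z') =
  tlift (fun (h : H) (y : Z) => pure h (y * z')) (coaction z).
Proof.
have b1 (w : Z) : bilin (fun (h : H) (y : Z) => pure h (y * w)).
  apply: (tmap_bilin (f := @id H) (g := fun y : Z => y * w)) => //.
  exact: kmul_linl.
rewrite /galois_map tlift_pure //; split=> [w|w] c x y.
  by rewrite (alg_morphism_lin (coaction_morphism Z)) tlift_linear.
apply: tlift_linf => // h u; by rewrite kmul_linr pure_linr.
Qed.
End Galois.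

Section PureLinear.
Variables (k : fieldType) (H Z : kalg k).

Lemma tpure_linl (b : Z) : linear (fun a : H => tpure a b).
Proof. exact: (@pure_linl k H Z b). Qed.
Lemma tpure_linr (a : H) : linear (fun b : Z => tpure a b).
Proof. exact: (@pure_linr k H Z a). Qed.
Lemma tpureZl c (a : H) (b : Z) : tpure (c *: a) b = c *: tpure a b.
Proof. exact: linZ (tpure_linl b) c a. Qed.
Lemma tpureZr c (a : H) (b : Z) : tpure a (c *: b) = c *: tpure a b.
Proof. exact: linZ (tpure_linr a) c b. Qed.
Lemma tpure_suml (b : Z) (I : Type) (r : seq I) (F : I -> H) :
  tpure (\sum_(i <- r) F i) b = \sum_(i <- r) tpure (F i) b.
Proof. exact: (lin_sum (tpure_linl b) r xpredT F). Qed.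
Lemma tpure_sumr (a : H) (I : Type) (r : seq I) (F : I -> Z) :
  tpure a (\sum_(i <- r) F i) = \sum_(i <- r) tpure a (F i).
Proof. exact: (lin_sum (tpure_linr a) r xpredT F). Qed.
End PureLinear.

Section GAlgebra.
Variable k : fieldType.

Inductive Ggen (n m : nat) : Type := Gx of 'I_n & 'I_m | Gd | Gdinv.
Arguments Gd {n m}.
Arguments Gdinv {n m}.

(* The entries of x^t A x = C d and of x D x^t = B d, and d d^-1 = 1 = d^-1 d. *)
Inductive Grel (n m : nat) (A B : 'M[k]_n) (C D : 'M[k]_m) :
    algterm k (Ggen n m) -> algterm k (Ggen n m) -> Prop :=
| Grel_AC i j : Grel A B C D
    (\big[@AAdd _ _/AZero]_(p < n) \big[@AAdd _ _/AZero]_(q < n)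
        AScale (A p q) (AMul (AGen (Gx p i)) (AGen (Gx q j))))
    (AScale (C i j) (AGen Gd))
| Grel_DB i j : Grel A B C D
    (\big[@AAdd _ _/AZero]_(p < m) \big[@AAdd _ _/AZero]_(q < m)
        AScale (D p q) (AMul (AGen (Gx i p)) (AGen (Gx j q))))
    (AScale (B i j) (AGen Gd))
| Grel_dr : Grel A B C D (AMul (AGen Gd) (AGen Gdinv)) AOne
| Grel_dl : Grel A B C D (AMul (AGen Gdinv) (AGen Gd)) AOne.

Lemma aeval_sum (X : Type) (Z : kalg k) (g : X -> Z) n
    (F : 'I_n -> algterm k X) :
  aeval g (\big[@AAdd _ _/AZero]_(i < n) F i) = \sum_(i < n) aeval g (F i).
Proof. by elim/big_rec2: _ => //= i y1 y2 _ ->. Qed.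

Section Fixed.
Variables (n m : nat) (A B : 'M[k]_n) (C D : 'M[k]_m).

Definition Galg : kalg k := presAlg (Grel A B C D).

Definition Ggx (i : 'I_n) (j : 'I_m) : Galg := pgen _ (Gx i j).
Definition Ggd : Galg := pgen _ Gd.
Definition Ggdinv : Galg := pgen _ Gdinv.

Lemma GrelAC i j :
  \sum_p \sum_q A p q *: (Ggx p i * Ggx q j) = C i j *: Ggd.
Proof.
have := pres_rel (Grel_AC A B C D i j); rewrite aeval_sum /= => <-.
by apply: eq_bigr => p _; rewrite aeval_sum.
Qed.
Lemma GrelDB i j :
  \sum_p \sum_q D p q *: (Ggx i p * Ggx j q) = B i j *: Ggd.
Proof.
have := pres_rel (Grel_DB A B C D i j); rewrite aeval_sum /= => <-.
by apply: eq_bigr => p _; rewrite aeval_sum.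
Qed.
Lemma Grel_ddinv : Ggd * Ggdinv = 1.
Proof. exact: (pres_rel (Grel_dr A B C D)). Qed.
Lemma Grel_dinvd : Ggdinv * Ggd = 1.
Proof. exact: (pres_rel (Grel_dl A B C D)). Qed.

Section Lift.
Variables (Z : kalg k) (x : 'I_n -> 'I_m -> Z) (d dinv : Z).

Definition Ggenmap (g : Ggen n m) : Z :=
  match g with Gx i j => x i j | Gd => d | Gdinv => dinv end.

Definition Glift : Galg -> Z := pres_lift Ggenmap.

Hypotheses
  (hAC : forall i j, \sum_p \sum_q A p q *: (x p i * x q j) = C i j *: d)
  (hDB : forall i j, \sum_p \sum_q D p q *: (x i p * x j q) = B i j *: d)
  (hr : d * dinv = 1) (hl : dinv * d = 1).

Lemma Ggenmap_rel s t : Grel A B C D s t -> aeval Ggenmap s = aeval Ggenmap t.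
Proof.
case=> [i j|i j||] //=; rewrite aeval_sum.
  by rewrite -hAC; apply: eq_bigr => p _; rewrite aeval_sum.
by rewrite -hDB; apply: eq_bigr => p _; rewrite aeval_sum.
Qed.

Lemma Glift_morphism : alg_morphism Glift.
Proof. exact: pres_lift_morphism Ggenmap_rel. Qed.
Lemma Glift_x i j : Glift (Ggx i j) = x i j.
Proof. exact: pres_lift_gen Ggenmap_rel _. Qed.
Lemma Glift_d : Glift Ggd = d.
Proof. exact: pres_lift_gen Ggenmap_rel _. Qed.
Lemma Glift_dinv : Glift Ggdinv = dinv.
Proof. exact: pres_lift_gen Ggenmap_rel _. Qed.
End Lift.

Lemma Gext (Z : kalg k) (f g : Galg -> Z) :
  alg_morphism f -> alg_morphism g ->
  (forall i j, f (Ggx i j) = g (Ggx i j)) -> f Ggd = g Ggd ->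
  f Ggdinv = g Ggdinv -> f =1 g.
Proof. by move=> hf hg e1 e2 e3; apply: pres_ext => //; case. Qed.
End Fixed.

Section Coaction.
Variables (n m : nat) (A B : 'M[k]_n) (C D : 'M[k]_m).
Local Notation H := (Galg A B A B).
Local Notation Z := (Galg A B C D).
Local Notation T := (tensA H Z).

Definition coact_x (i : 'I_n) (j : 'I_m) : T :=
  \sum_(l < n) tpure (Ggx A B A B i l) (Ggx A B C D l j).
Definition coact_d : T := tpure (Ggd A B A B) (Ggd A B C D).
Definition coact_dinv : T := tpure (Ggdinv A B A B) (Ggdinv A B C D).

Definition Gcoact : Z -> T := Glift coact_x coact_d coact_dinv.

Lemma coact_xM i j p q : coact_x p i * coact_x q j =
  \sum_l \sum_r tpure (Ggx A B A B p l * Ggx A B A B q r)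
                      (Ggx A B C D l i * Ggx A B C D r j).
Proof.
rewrite mulr_suml; apply: eq_bigr => l _; rewrite mulr_sumr.
by apply: eq_bigr => r _; rewrite tpureM.
Qed.

Lemma coact_AC i j :
  \sum_p \sum_q A p q *: (coact_x p i * coact_x q j) = C i j *: coact_d.
Proof.
rewrite -tpureZr -GrelAC tpure_sumr.
under [RHS]eq_bigr do rewrite tpure_sumr.
under [LHS]eq_bigr => p _ do under eq_bigr => q _ do rewrite coact_xM scaler_sumr.
under eq_bigr => p _ do rewrite exchange_big /=.
rewrite exchange_big /=; apply: eq_bigr => l _.
under eq_bigr => p _ do under eq_bigr => q _ do rewrite scaler_sumr.
under eq_bigr => p _ do rewrite exchange_big /=.
rewrite exchange_big /=; apply: eq_bigr => r _.
rewrite tpureZr -tpureZl -GrelAC tpure_suml; apply: eq_bigr => p _.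
by rewrite tpure_suml; apply: eq_bigr => q _; rewrite tpureZl.
Qed.

Lemma coact_DB i j :
  \sum_p \sum_q D p q *: (coact_x i p * coact_x j q) = B i j *: coact_d.
Proof.
rewrite -tpureZl -GrelDB tpure_suml.
under [RHS]eq_bigr do rewrite tpure_suml.
under [LHS]eq_bigr => p _ do under eq_bigr => q _ do rewrite coact_xM scaler_sumr.
under eq_bigr => p _ do rewrite exchange_big /=.
rewrite exchange_big /=; apply: eq_bigr => l _.
under eq_bigr => p _ do under eq_bigr => q _ do rewrite scaler_sumr.
under eq_bigr => p _ do rewrite exchange_big /=.
rewrite exchange_big /=; apply: eq_bigr => r _.
rewrite tpureZl -tpureZr -GrelDB tpure_sumr; apply: eq_bigr => p _.
by rewrite tpure_sumr; apply: eq_bigr => q _; rewrite tpureZr.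
Qed.

Lemma coact_dr : coact_d * coact_dinv = 1.
Proof. by rewrite tpureM !Grel_ddinv. Qed.
Lemma coact_dl : coact_dinv * coact_d = 1.
Proof. by rewrite tpureM !Grel_dinvd. Qed.

Lemma Gcoact_morphism : alg_morphism Gcoact.
Proof. exact: Glift_morphism coact_AC coact_DB coact_dr coact_dl. Qed.
Lemma Gcoact_x i j : Gcoact (Ggx A B C D i j) =
  \sum_(l < n) tpure (Ggx A B A B i l) (Ggx A B C D l j).
Proof. by rewrite /Gcoact (Glift_x coact_AC coact_DB coact_dr coact_dl). Qed.
Lemma Gcoact_d : Gcoact (Ggd A B C D) = tpure (Ggd A B A B) (Ggd A B C D).
Proof. by rewrite /Gcoact (Glift_d coact_AC coact_DB coact_dr coact_dl). Qed.
Lemma Gcoact_dinv :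
  Gcoact (Ggdinv A B C D) = tpure (Ggdinv A B A B) (Ggdinv A B C D).
Proof. by rewrite /Gcoact (Glift_dinv coact_AC coact_DB coact_dr coact_dl). Qed.

End Coaction.

Section Counit.
Variables (n : nat) (A B : 'M[k]_n).

Definition Gcounit : Galg A B A B -> k :=
  Glift (Z := ground_alg k) (fun i j => (i == j)%:R : k) 1 1.

Lemma delta_sum (M : 'M[k]_n) i j :
  \sum_p \sum_q M p q *: ((p == i)%:R * (q == j)%:R : k^o) = M i j.
Proof.
rewrite (bigD1 i) //= [X in _ + X]big1 => [|p /negPf ne]; last first.
  by rewrite big1 // => q _; rewrite ne mul0r scaler0.
rewrite addr0 (bigD1 j) //= [X in _ + X]big1 => [|q /negPf ne].
  by rewrite !eqxx mulr1 addr0 [LHS]mulr1.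
by rewrite ne mulr0 scaler0.
Qed.

Lemma counit_AC i j : \sum_p \sum_q A p q *:
  (((p == i)%:R : ground_alg k) * ((q == j)%:R : ground_alg k)) =
  A i j *: (1 : ground_alg k).
Proof. by rewrite [RHS]mulr1; apply: delta_sum. Qed.
Lemma counit_DB i j : \sum_p \sum_q B p q *:
  (((i == p)%:R : ground_alg k) * ((j == q)%:R : ground_alg k)) =
  B i j *: (1 : ground_alg k).
Proof.
rewrite -[RHS]/(B i j * 1) mulr1 -[RHS]delta_sum; apply: eq_bigr => p _.
by apply: eq_bigr => q _; rewrite ![_ == i]eq_sym ![_ == j]eq_sym.
Qed.
Lemma counit_d : (1 : ground_alg k) * 1 = 1.
Proof. exact: mulr1. Qed.

Lemma Gcounit_morphism :
  alg_morphism (Gcounit : Galg A B A B -> ground_alg k).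
Proof. exact: Glift_morphism counit_AC counit_DB counit_d counit_d. Qed.
Lemma Gcounit_x i j : Gcounit (Ggx A B A B i j) = (i == j)%:R.
Proof. exact: (Glift_x counit_AC counit_DB counit_d counit_d). Qed.
Lemma Gcounit_d : Gcounit (Ggd A B A B) = 1.
Proof. exact: (Glift_d counit_AC counit_DB counit_d counit_d). Qed.
Lemma Gcounit_dinv : Gcounit (Ggdinv A B A B) = 1.
Proof. exact: (Glift_dinv counit_AC counit_DB counit_d counit_d). Qed.
End Counit.

Section Coassociativity.
Variables (n m : nat) (A B : 'M[k]_n) (C D : 'M[k]_m).
Local Notation H := (Galg A B A B).
Local Notation Z := (Galg A B C D).

Lemma GcoactA (z : Z) :
  tassoc (tmap (@Gcoact n n A B A B) (@id Z) (Gcoact z)) =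
  tmap (@id H) (@Gcoact n m A B C D) (Gcoact z).
Proof.
have hD := Gcoact_morphism A B A B; have hZ := Gcoact_morphism A B C D.
have hDl := alg_morphism_lin hD; have hZl := alg_morphism_lin hZ.
have m1 := tmap_morphism hD (@alg_morphism_id _ Z).
have m2 := tmap_morphism (@alg_morphism_id _ H) hZ.
have l1 := alg_morphism_lin m1; have l2 := alg_morphism_lin m2.
have la := @tassoc_linear k H H Z.
pose f := (@tassoc k H H Z : tensA (tensA H H) Z -> tensA H (tensA H Z)) \o
  ((tmap (@Gcoact n n A B A B) (@id Z) : tensA H Z -> tensA (tensA H H) Z) \o
   (@Gcoact n m A B C D)).
pose g := (tmap (@id H) (@Gcoact n m A B C D) :
  tensA H Z -> tensA H (tensA H Z)) \o (@Gcoact n m A B C D).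
have fm : alg_morphism f.
  apply: alg_morphism_comp; first exact: tassoc_morphism.
  exact: alg_morphism_comp.
have gm : alg_morphism g by apply: alg_morphism_comp.
suff E : f =1 g by exact: E.
apply: Gext => // [i j||]; rewrite /f /g /=.
- rewrite Gcoact_x (lin_sum l1) (lin_sum la) (lin_sum l2).
  under eq_bigr => l _.
    rewrite (tmap_pure _ _ hDl (@alg_morphism_lin _ Z Z _ (@alg_morphism_id _ Z))).
    rewrite Gcoact_x (lin_sum (pure_linl _)) (lin_sum la).
    under eq_bigr => r _ do rewrite tassoc_pure.
    over.
  rewrite exchange_big /=; apply: eq_bigr => l _.
  rewrite [in RHS](tmap_pure _ _ (@alg_morphism_lin _ H H _ (@alg_morphism_id _ H)) hZl).
  by rewrite Gcoact_x (lin_sum (pure_linr _)).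
- rewrite Gcoact_d (tmap_pure _ _ hDl (alg_morphism_lin (@alg_morphism_id _ Z))).
  rewrite (tmap_pure _ _ (alg_morphism_lin (@alg_morphism_id _ H)) hZl).
  by rewrite !Gcoact_d tassoc_pure.
- rewrite Gcoact_dinv (tmap_pure _ _ hDl (alg_morphism_lin (@alg_morphism_id _ Z))).
  rewrite (tmap_pure _ _ (alg_morphism_lin (@alg_morphism_id _ H)) hZl).
  by rewrite !Gcoact_dinv tassoc_pure.
Qed.

Lemma counit_bilin :
  bilin (fun (h : H) (y : Z) => Gcounit h *: y).
Proof.
have [cl _] := Gcounit_morphism A B.
split=> [y|h] c a b; first by rewrite cl scalerDl -scalerA.
by rewrite scalerDr !scalerA mulrC.
Qed.

Lemma Gcoact_counit (z : Z) :
  tlift (fun (h : H) (y : Z) => Gcounit h *: y) (Gcoact z) = z.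
Proof.
have bl := counit_bilin; have [cl [c1 cM]] := Gcounit_morphism A B.
pose e : tensA H Z -> Z := tlift (fun (h : H) (y : Z) => Gcounit h *: y).
have em : alg_morphism e.
  split; first exact: tlift_linear.
  split; first by rewrite /e -tpure1 tlift_pure // c1 scale1r.
  move=> s t; suff : e (tmul s t) = e s * e t by [].
  have el : linear e by exact: tlift_linear.
  elim/tens_ind: s => [a b|c s s' IH IH'].
    elim/tens_ind: t => [a' b'|c t t' IH IH'].
      rewrite tmul_pure /e !tlift_pure // cM.
      by rewrite -kscalerAl -kscalerAr scalerA.
    by rewrite tmul_linr !el IH IH' kmul_linr.
  by rewrite tmul_linl !el IH IH' kmul_linl.
have fm : alg_morphism (e \o @Gcoact n m A B C D).
  by apply: alg_morphism_comp => //; apply: Gcoact_morphism.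
suff E : e \o @Gcoact n m A B C D =1 id by exact: E.
apply: Gext => // [i j||] /=.
- rewrite Gcoact_x (lin_sum (alg_morphism_lin em)) (bigD1 i) //= big1 => [|l ne].
    by rewrite /e tlift_pure // Gcounit_x eqxx scale1r addr0.
  by rewrite /e tlift_pure // Gcounit_x eq_sym (negPf ne) scale0r.
- by rewrite Gcoact_d /e tlift_pure // Gcounit_d scale1r.
- by rewrite Gcoact_dinv /e tlift_pure // Gcounit_dinv scale1r.
Qed.
End Coassociativity.

Lemma Gcounitr (n : nat) (A B : 'M[k]_n) (z : Galg A B A B) :
  tlift (fun a b : Galg A B A B => Gcounit b *: a) (Gcoact z) = z.
Proof.
have [cl [c1 cM]] := Gcounit_morphism A B.
have bl : bilin (fun a b : Galg A B A B => Gcounit b *: a).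
  split=> [h|y] c a b; first by rewrite scalerDr !scalerA mulrC.
  by rewrite cl scalerDl -scalerA.
set H := Galg A B A B in z bl *.
pose e : tensA H H -> H := tlift (fun a b : H => Gcounit b *: a).
have em : alg_morphism e.
  split; first exact: tlift_linear.
  split; first by rewrite /e -tpure1 tlift_pure // c1 scale1r.
  move=> s t; suff : e (tmul s t) = e s * e t by [].
  have el : linear e by exact: tlift_linear.
  elim/tens_ind: s => [a b|c s s' IH IH'].
    elim/tens_ind: t => [a' b'|c t t' IH IH'].
      rewrite tmul_pure /e !tlift_pure // cM.
      by rewrite -kscalerAl -kscalerAr scalerA.
    by rewrite tmul_linr !el IH IH' kmul_linr.
  by rewrite tmul_linl !el IH IH' kmul_linl.
have fm : alg_morphism (e \o @Gcoact n n A B A B).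
  by apply: alg_morphism_comp => //; apply: Gcoact_morphism.
suff E : e \o @Gcoact n n A B A B =1 id by exact: E.
apply: Gext => // [i j||] /=.
- rewrite Gcoact_x (lin_sum (alg_morphism_lin em)) (bigD1 j) //= big1 => [|l ne].
    by rewrite /e tlift_pure // Gcounit_x eqxx scale1r addr0.
  by rewrite /e tlift_pure // Gcounit_x (negPf ne) scale0r.
- by rewrite Gcoact_d /e tlift_pure // Gcounit_d scale1r.
- by rewrite Gcoact_dinv /e tlift_pure // Gcounit_dinv scale1r.
Qed.

Definition Gbialg (n : nat) (A B : 'M[k]_n) : bialgebra k :=
  Bialgebra (Gcoact_morphism A B A B) (Gcounit_morphism A B)
    (@GcoactA n n A B A B) (@Gcoact_counit n n A B A B) (@Gcounitr n A B).

Definition Gcomod (n m : nat) (A B : 'M[k]_n) (C D : 'M[k]_m) :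
    comodAlg (Gbialg A B) :=
  @ComodAlg k (Gbialg A B) (Galg A B C D) (@Gcoact n m A B C D)
    (Gcoact_morphism A B C D) (@GcoactA n m A B C D)
    (@Gcoact_counit n m A B C D).

End GAlgebra.

Lemma mx_aux1 (H : pzRingType) (n : nat)
    (Bi X D BT AT Bm XT Bi' L AI : 'M[H]_n) :
  BT *m AT *m Bm = L *m AI -> X *m D *m AI *m XT = AI ->
  (forall M, L *m M = M *m L) -> D *m Bi' = Bi' *m D ->
  Bi *m X *m D *m BT *m AT *m (Bm *m XT *m D *m Bi') =
  L *m (Bi *m AI *m Bi') *m D.
Proof.
move=> e1 e2 hL hD.
have -> : Bi *m X *m D *m BT *m AT *m (Bm *m XT *m D *m Bi') =
  Bi *m (X *m D *m (BT *m AT *m Bm) *m XT) *m (D *m Bi') by rewrite !mulmxA.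
rewrite e1 hD (mulmxA (X *m D)) -(hL (X *m D)).
have -> : L *m (X *m D) *m AI *m XT = L *m AI by rewrite -[in RHS]e2 !mulmxA.
by rewrite !mulmxA -(hL Bi).
Qed.

Lemma mx_aux2 (H : pzRingType) (n : nat)
    (D AI XT Am BT AT X ATi L BI : 'M[H]_n) :
  Am *m BT *m AT = L *m BI -> XT *m D *m BI *m X = BI ->
  (forall M, L *m M = M *m L) -> Am *m BT *m D = D *m (Am *m BT) ->
  D *m AI *m XT *m Am *m BT *m (D *m AT *m X *m ATi) =
  D *m (L *m (AI *m BI *m ATi)).
Proof.
move=> e1 e2 hL hD.
have -> : D *m AI *m XT *m Am *m BT *m (D *m AT *m X *m ATi) =
  D *m AI *m (XT *m (Am *m BT *m D) *m AT *m X) *m ATi by rewrite !mulmxA.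
rewrite hD.
have -> : XT *m (D *m (Am *m BT)) *m AT *m X =
  XT *m D *m (Am *m BT *m AT) *m X by rewrite !mulmxA.
rewrite e1 (mulmxA (XT *m D)) -(hL (XT *m D)).
have -> : L *m (XT *m D) *m BI *m X = L *m BI by rewrite -[in RHS]e2 !mulmxA.
by rewrite !mulmxA -(hL (D *m AI)) -!mulmxA (mulmxA D L) -(hL D) !mulmxA.
Qed.

Lemma mx_aux3 (H : pzRingType) (n : nat) (X D AI XT Am : 'M[H]_n) :
  X *m (D *m AI *m XT *m Am) = 1%:M -> Am *m AI = 1%:M ->
  X *m D *m AI *m XT = AI.
Proof.
move=> e h; rewrite -[LHS]mulmx1 -h !mulmxA -[RHS]mul1mx -e.
by rewrite !mulmxA.
Qed.

Lemma mx_aux4 (H : pzRingType) (n : nat) (Bm XT D BI X : 'M[H]_n) :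
  Bm *m XT *m D *m BI *m X = 1%:M -> BI *m Bm = 1%:M ->
  XT *m D *m BI *m X = BI.
Proof.
by move=> e h; rewrite -[LHS]mul1mx -h -[RHS]mulmx1 -e !mulmxA.
Qed.

Definition kop (k : fieldType) (K : kalg k) : kalg k :=
  @KAlg k K 1 (fun a b : K => b * a) (fun a b c => esym (mulrA c b a))
    (@mulr1 K) (@mul1r K) (fun a b c => mulrDr c a b) (fun a b c => mulrDl b c a)
    (fun c a b => kscalerAr c b a) (fun c a b => kscalerAl c b a).

Section Antihom.
Variables (k : fieldType) (H : bialgebra k) (S : H -> H).
Hypothesis Sm : alg_morphism (S : H -> kop H).

Let Sl : linear S. Proof. exact: (proj1 Sm). Qed.
Let S1 : S 1 = 1. Proof. exact: (proj1 (proj2 Sm)). Qed.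
Let SM a b : S (a * b) = S b * S a. Proof. exact: (proj2 (proj2 Sm)). Qed.

Lemma antil_bilin (c : H) : bilin (fun a b : H => S a * c * b).
Proof.
split=> [b|a] e x y; last by rewrite kmul_linr.
by rewrite Sl kmul_linl kmul_linl.
Qed.
Lemma antir_bilin (c : H) : bilin (fun a b : H => a * c * S b).
Proof.
split=> [b|a] e x y; last by rewrite Sl kmul_linr.
by rewrite kmul_linl kmul_linl.
Qed.
Lemma antil_bilin1 : bilin (fun a b : H => S a * b).
Proof.
split=> [b|a] e x y; last by rewrite kmul_linr.
by rewrite Sl kmul_linl.
Qed.
Lemma antir_bilin1 : bilin (fun a b : H => a * S b).
Proof.
split=> [b|a] e x y; last by rewrite Sl kmul_linr.
by rewrite kmul_linl.
Qed.

Lemma antil_mul (s t : tens H H) :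
  tlift (fun a b : H => S a * b) (tmul s t : tens H H) =
  tlift (fun a b : H => S a * (tlift (fun a b : H => S a * b) s) * b) t.
Proof.
have L := tlift_linear antil_bilin1.
elim/tens_ind: t => [c d|e t t' IH IH']; last first.
  rewrite tmul_linr L IH IH' [RHS]tlift_linear //; exact: antil_bilin.
rewrite tlift_pure; last exact: antil_bilin.
elim/tens_ind: s => [a b|e s s' IH IH'].
  rewrite tmul_pure !tlift_pure ?SM ?mulrA //; exact: antil_bilin1.
by rewrite tmul_linl !L kmul_linr kmul_linl IH IH'.
Qed.
Lemma antir_mul (s t : tens H H) :
  tlift (fun a b : H => a * S b) (tmul s t : tens H H) =
  tlift (fun a b : H => a * (tlift (fun a b : H => a * S b) t) * S b) s.
Proof.
have L := tlift_linear antir_bilin1.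
elim/tens_ind: s => [c d|e t0 t' IH IH']; last first.
  rewrite tmul_linl L IH IH' [RHS]tlift_linear //; exact: antir_bilin.
rewrite tlift_pure; last exact: antir_bilin.
elim/tens_ind: t => [a b|e s s' IH IH'].
  rewrite tmul_pure !tlift_pure ?SM ?mulrA //; exact: antir_bilin1.
by rewrite tmul_linr !L kmul_linr kmul_linl IH IH'.
Qed.

Definition antiP (h : H) : Prop :=
  tlift (fun a b : H => S a * b) (comult h) = counit h *: (1 : H) /\
  tlift (fun a b : H => a * S b) (comult h) = counit h *: (1 : H).

Lemma antiP1 : antiP 1.
Proof.
have [_ [D1 _]] := comult_morphism H; have [_ [e1 _]] := counit_morphism H.
rewrite /antiP D1 -tpure1 !tlift_pure; try exact: antil_bilin1;
  try exact: antir_bilin1.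
by rewrite S1 mulr1 e1 scale1r.
Qed.

Lemma antiP_lin c h h' : antiP h -> antiP h' -> antiP (c *: h + h').
Proof.
have [Dl _] := comult_morphism H; have [el _] := counit_morphism H.
move=> [a1 a2] [b1 b2]; rewrite /antiP Dl el.
rewrite (tlift_linear antil_bilin1) (tlift_linear antir_bilin1) a1 a2 b1 b2.
by rewrite scalerDl scalerA.
Qed.

Lemma antiP_mul h h' : antiP h -> antiP h' -> antiP (h * h').
Proof.
have [_ [_ DM]] := comult_morphism H; have [_ [_ eM]] := counit_morphism H.
have eM' : counit (h * h') = (counit h : k) * (counit h' : k) := eM h h'.
move=> [a1 a2] [b1 b2]; rewrite /antiP DM eM' antil_mul antir_mul a1 b2.
split.
- rewrite -scalerA -b1; elim/tens_ind: (comult h') => [a b|c s t IH IH'].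
    rewrite !tlift_pure; try exact: antil_bilin1; try exact: antil_bilin.
    by rewrite -kscalerAr mulr1 kscalerAl.
  rewrite (tlift_linear antil_bilin1) (tlift_linear (antil_bilin _)) IH IH'.
  by rewrite scalerDr !scalerA mulrC.
- rewrite [counit h * _]mulrC -scalerA -a2.
  elim/tens_ind: (comult h) => [a b|c s t IH IH'].
    rewrite !tlift_pure; try exact: antir_bilin1; try exact: antir_bilin.
    by rewrite -kscalerAr mulr1 kscalerAl.
  rewrite (tlift_linear antir_bilin1) (tlift_linear (antir_bilin _)) IH IH'.
  by rewrite scalerDr !scalerA mulrC.
Qed.
End Antihom.

Lemma pres_ind (k : fieldType) (X : Type) R (P : @presAlg k X R -> Prop) :
  P 1 -> (forall x, P (pgen R x)) ->
  (forall c a b, P a -> P b -> P (c *: a + b)) ->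
  (forall a b, P a -> P b -> P (a * b)) -> forall a, P a.
Proof.
move=> P1 Pg PD PM.
have P0 : P 0 by have := PD (-1) _ _ P1 P1; rewrite scaleN1r addNr.
elim/presW=> s; rewrite -aeval_pi.
elim: s => //= [c s IH|s IHs t IHt|s IHs t IHt].
- by rewrite -[_ *: _]addr0; apply: PD.
- by rewrite -[aeval _ s]scale1r; apply: PD.
- exact: PM.
Qed.

(* When B^t A^t B A is a scalar matrix, the bialgebra G(A,B) is a Hopf algebra,
   with S(x) = d^-1 A^-1 x^t A and S(d^(+-1)) = d^(-+1). *)
Section Antipode.
Variables (k : fieldType) (n : nat) (A B : 'M[k]_n) (lam : k).
Hypotheses (hA : A \in unitmx) (hB : B \in unitmx).
Hypothesis hAB : B^T *m A^T *m B *m A = lam%:M.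

Local Notation H := (Galg A B A B).
Local Notation d := (Ggd A B A B).
Local Notation di := (Ggdinv A B A B).

Definition Gmx (M : 'M[k]_n) : 'M[H]_n := map_mx (fun c : k => c *: (1 : H)) M.
Definition GX : 'M[H]_n := \matrix_(i, j) Ggx A B A B i j.

Lemma Gmx_scalar (M : 'M[k]_n) (a : H) :
  Gmx M *m a%:M = map_mx (fun c : k => c *: a) M.
Proof.
apply/matrixP=> i j; rewrite !mxE (bigD1 j) //= big1 => [|l ne].
  by rewrite !mxE eqxx mulr1n addr0 -kscalerAl mul1r.
by rewrite !mxE (negPf ne) mulr0n mulr0.
Qed.
Lemma Gscalar_mx (M : 'M[k]_n) (a : H) :
  a%:M *m Gmx M = map_mx (fun c : k => c *: a) M.
Proof.
apply/matrixP=> i j; rewrite !mxE (bigD1 i) //= big1 => [|l ne].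
  by rewrite !mxE eqxx mulr1n addr0 -kscalerAr mulr1.
by rewrite !mxE eq_sym (negPf ne) mulr0n mul0r.
Qed.
Lemma Gmx_comm M a : Gmx M *m a%:M = a%:M *m Gmx M.
Proof. by rewrite Gmx_scalar Gscalar_mx. Qed.
Lemma GmxM M N : Gmx (M *m N) = Gmx M *m Gmx N.
Proof.
apply/matrixP=> i j; rewrite !mxE scaler_suml; apply: eq_bigr => l _.
by rewrite !mxE -kscalerAl mul1r scalerA.
Qed.
Lemma Gmx1 : Gmx 1%:M = 1%:M.
Proof.
by apply/matrixP=> i j; rewrite !mxE; case: eqP; rewrite ?scale1r ?scale0r.
Qed.
Lemma Gdi : d%:M *m di%:M = 1%:M :> 'M[H]_n.
Proof. by rewrite -scalar_mxM Grel_ddinv. Qed.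
Lemma Gid : di%:M *m d%:M = 1%:M :> 'M[H]_n.
Proof. by rewrite -scalar_mxM Grel_dinvd. Qed.
Lemma GmxV M : M \in unitmx -> Gmx M *m Gmx (invmx M) = 1%:M.
Proof. by move=> hM; rewrite -GmxM mulmxV // Gmx1. Qed.
Lemma GVmx M : M \in unitmx -> Gmx (invmx M) *m Gmx M = 1%:M.
Proof. by move=> hM; rewrite -GmxM mulVmx // Gmx1. Qed.

Lemma GXA : GX^T *m Gmx A *m GX = Gmx A *m d%:M.
Proof.
rewrite Gmx_scalar; apply/matrixP=> i j; rewrite !mxE -GrelAC exchange_big /=.
apply: eq_bigr => q _; rewrite !mxE mulr_suml; apply: eq_bigr => p _.
by rewrite !mxE -kscalerAr mulr1 -kscalerAl.
Qed.
Lemma GXB : GX *m Gmx B *m GX^T = Gmx B *m d%:M.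
Proof.
rewrite Gmx_scalar; apply/matrixP=> i j; rewrite !mxE -GrelDB exchange_big /=.
apply: eq_bigr => q _; rewrite !mxE mulr_suml; apply: eq_bigr => p _.
by rewrite !mxE -kscalerAr mulr1 -kscalerAl.
Qed.

Definition GS : 'M[H]_n := di%:M *m Gmx (invmx A) *m GX^T *m Gmx A.
Let R : 'M[H]_n := Gmx B *m GX^T *m di%:M *m Gmx (invmx B).

Lemma GSX : GS *m GX = 1%:M.
Proof.
rewrite /GS -!mulmxA (mulmxA GX^T) GXA (mulmxA (Gmx (invmx A))) GVmx //.
by rewrite mul1mx Gid.
Qed.
Lemma GXR : GX *m R = 1%:M.
Proof.
rewrite /R !mulmxA GXB -(mulmxA (Gmx B)) Gdi mulmx1 GmxV //.
Qed.
Lemma GRS : R = GS.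
Proof. by rewrite -[R]mul1mx -GSX -mulmxA GXR mulmx1. Qed.
Lemma GXS : GX *m GS = 1%:M.
Proof. by rewrite -GRS GXR. Qed.

Lemma hABt : A^T *m (B *m A *m B^T) = lam%:M.
Proof.
have hu : B^T \in unitmx by rewrite unitmx_tr.
have: B^T *m (A^T *m (B *m A *m B^T)) = B^T *m lam%:M.
  by rewrite !mulmxA hAB scalar_mxC.
by move/(congr1 (mulmx (invmx B^T))); rewrite !mulKmx.
Qed.

Lemma GStr : GS^T = di%:M *m Gmx A^T *m GX *m Gmx (invmx A)^T.
Proof.
apply/matrixP=> i j; rewrite /GS.
rewrite [di%:M *m Gmx (invmx A)]Gscalar_mx [di%:M *m Gmx A^T]Gscalar_mx !mxE.
under eq_bigr => q _ do (rewrite !mxE mulr_suml;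
  under eq_bigr => p _ do rewrite !mxE -kscalerAr mulr1 -!kscalerAl scalerA).
under [RHS]eq_bigr => q _ do (rewrite !mxE mulr_suml;
  under eq_bigr => p _ do rewrite !mxE -kscalerAr mulr1 -!kscalerAl scalerA mulrC).
by rewrite exchange_big.
Qed.

Lemma GRtr : GS^T = Gmx (invmx B)^T *m GX *m di%:M *m Gmx B^T.
Proof.
apply/matrixP=> i j; rewrite -GRS /R -!mulmxA -!Gmx_comm !mulmxA.
rewrite -2![_ *m Gmx _ *m di%:M]mulmxA !Gmx_scalar !mxE.
under eq_bigr => q _ do (rewrite !mxE mulr_suml;
  under eq_bigr => p _ do
    rewrite !mxE -kscalerAl mul1r -kscalerAr -kscalerAl scalerA).
under [RHS]eq_bigr => q _ do (rewrite !mxE mulr_suml;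
  under eq_bigr => p _ do
    rewrite !mxE -kscalerAl mul1r -kscalerAr -kscalerAl scalerA mulrC).
by rewrite exchange_big.
Qed.

Lemma lam_inv (M N : 'M[k]_n) : N \in unitmx -> M *m N = lam%:M ->
  lam%:M *m invmx N = M.
Proof. by move=> hN <-; rewrite mulmxK. Qed.

Lemma AT_eq : A^T = lam%:M *m ((invmx B)^T *m invmx A *m invmx B).
Proof.
have hu : B^T \in unitmx by rewrite unitmx_tr.
by rewrite -hABt trmx_inv !mulmxA !mulmxK.
Qed.
Lemma BT_eq : B^T = lam%:M *m (invmx A *m invmx B *m (invmx A)^T).
Proof.
have hu : A^T \in unitmx by rewrite unitmx_tr.
by rewrite -scalar_mxC -hABt trmx_inv !mulmxA !mulmxKV // mulVmx // mul1mx.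
Qed.

Lemma Glam_comm (M : 'M[H]_n) : Gmx lam%:M *m M = M *m Gmx lam%:M.
Proof.
have -> : Gmx lam%:M = (lam *: (1 : H))%:M.
  apply/matrixP=> i j; rewrite !mxE; case: eqP; rewrite ?mulr1n ?mulr0n //.
  by rewrite scale0r.
apply/matrixP=> i j; rewrite !mxE (bigD1 i) //= big1 => [|l ne]; last first.
  by rewrite !mxE eq_sym (negPf ne) mulr0n mul0r.
rewrite [RHS](bigD1 j) //= [X in _ = _ + X]big1 => [|l ne]; last first.
  by rewrite !mxE (negPf ne) mulr0n mulr0.
by rewrite !mxE !eqxx !mulr1n -kscalerAl -kscalerAr mul1r mulr1.
Qed.

Lemma GSA : GS^T *m Gmx A^T *m GS = Gmx A^T *m di%:M.
Proof.
have e1 : B^T *m A^T *m B = lam%:M *m invmx A by rewrite -hAB mulmxK.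
have e2 : GX *m di%:M *m Gmx (invmx A) *m GX^T = Gmx (invmx A).
  by apply: mx_aux3 GXS _; apply: GmxV.
rewrite GRtr -[X in _ *m X]GRS /R [in RHS]AT_eq !GmxM.
apply: mx_aux1 => //; last by rewrite Gmx_comm.
  by rewrite -!GmxM e1.
exact: Glam_comm.
Qed.

Lemma GSB : GS *m Gmx B^T *m GS^T = di%:M *m Gmx B^T.
Proof.
have e1 : A *m B^T *m A^T = lam%:M *m invmx B.
  have hu : A^T \in unitmx by rewrite unitmx_tr.
  by rewrite BT_eq trmx_inv !mulmxA scalar_mxC mulmxK // mulmxKV.
have e2 : GX^T *m di%:M *m Gmx (invmx B) *m GX = Gmx (invmx B).
  by apply: mx_aux4 (GVmx hB); rewrite -[RHS]GSX -GRS.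
rewrite GStr /GS [in RHS]BT_eq !GmxM.
apply: mx_aux2 => //.
- by rewrite -!GmxM e1.
- exact: Glam_comm.
- by rewrite -GmxM Gmx_comm.
Qed.

Definition Gantipode (h : H) : H :=
  Glift (Z := kop H) (fun i j => GS i j : kop H) di d h.

Lemma anti_AC i j :
  \sum_p \sum_q A p q *: ((GS p i : kop H) * (GS q j : kop H)) =
  A i j *: (di : kop H).
Proof.
have /matrixP/(_ j i) := GSA; rewrite Gmx_scalar !mxE => <-.
apply: eq_bigr => p _; rewrite !mxE mulr_suml; apply: eq_bigr => q _.
by rewrite !mxE -kscalerAr mulr1 -kscalerAl.
Qed.
Lemma anti_DB i j :
  \sum_p \sum_q B p q *: ((GS i p : kop H) * (GS j q : kop H)) =
  B i j *: (di : kop H).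
Proof.
have /matrixP/(_ j i) := GSB; rewrite Gscalar_mx !mxE => <-.
apply: eq_bigr => p _; rewrite !mxE mulr_suml; apply: eq_bigr => q _.
by rewrite !mxE -kscalerAr mulr1 -kscalerAl.
Qed.
Lemma anti_dr : (di : kop H) * (d : kop H) = 1.
Proof. exact: Grel_ddinv. Qed.
Lemma anti_dl : (d : kop H) * (di : kop H) = 1.
Proof. exact: Grel_dinvd. Qed.

Lemma Gantipode_morphism : alg_morphism (Gantipode : H -> kop H).
Proof. exact: Glift_morphism anti_AC anti_DB anti_dr anti_dl. Qed.
Lemma Gantipode_x i j : Gantipode (Ggx A B A B i j) = GS i j.
Proof. exact: (Glift_x anti_AC anti_DB anti_dr anti_dl). Qed.
Lemma Gantipode_d : Gantipode d = di.
Proof. exact: (Glift_d anti_AC anti_DB anti_dr anti_dl). Qed.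
Lemma Gantipode_dinv : Gantipode di = d.
Proof. exact: (Glift_dinv anti_AC anti_DB anti_dr anti_dl). Qed.

Lemma Gantipode_is_antipode : is_antipode (H := Gbialg A B) Gantipode.
Proof.
have Sm : alg_morphism (Gantipode : Gbialg A B -> kop (Gbialg A B)).
  exact: Gantipode_morphism.
split=> [|h]; first exact: (proj1 Sm).
suff : antiP (H := Gbialg A B) Gantipode h by [].
elim/pres_ind: h => [|g|c a b|a b]; [exact: antiP1 Sm| |exact: antiP_lin Sm _ _ _|
  exact: antiP_mul Sm _ _].
have lin_f := tlift_linear (antil_bilin1 Sm).
have lin_g := tlift_linear (antir_bilin1 Sm).
case: g => [i j||]; rewrite /antiP /=.
- rewrite -[pgen _ _]/(Ggx A B A B i j) Gcoact_x Gcounit_x.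
  rewrite (lin_sum lin_f) (lin_sum lin_g); split.
    have /matrixP/(_ i j) := GSX; rewrite !mxE.
    have -> : (i == j)%:R *: (1 : H) = 1 *+ (i == j).
      by case: eqP; rewrite ?scale1r ?scale0r.
    move=> <-; apply: eq_bigr => l _.
    rewrite tlift_pure; last exact: antil_bilin1.
    by rewrite Gantipode_x [GX _ _]mxE.
  have /matrixP/(_ i j) := GXS; rewrite !mxE.
  have -> : (i == j)%:R *: (1 : H) = 1 *+ (i == j).
    by case: eqP; rewrite ?scale1r ?scale0r.
  move=> <-; apply: eq_bigr => l _.
  rewrite tlift_pure; last exact: antir_bilin1.
  rewrite Gantipode_x [GX _ _]mxE //.
- rewrite -[pgen _ _]/d Gcoact_d Gcounit_d scale1r.
  rewrite (tlift_pure _ _ (antil_bilin1 Sm)) (tlift_pure _ _ (antir_bilin1 Sm)).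
  by rewrite Gantipode_d Grel_ddinv Grel_dinvd.
- rewrite -[pgen _ _]/di Gcoact_dinv Gcounit_dinv scale1r.
  rewrite (tlift_pure _ _ (antil_bilin1 Sm)) (tlift_pure _ _ (antir_bilin1 Sm)).
  by rewrite Gantipode_dinv Grel_ddinv Grel_dinvd.
Qed.
End Antipode.

(* Main.v *)
(** If [f] is a colinear algebra map, then [f(x1)] and the generating matrix
    [x2] of the target obey the same rule under the coaction. As [x2] is
    invertible, [x2^-1 f(x1)] has coinvariant entries, and these are scalars
    because the target is a Galois object; in the same way [f(d1)] is a scalar
    multiple of [d2]. So [f(x1) = x2 N] and [f(d1) = mu d2]. The same for the
    inverse of [f] makes [N] invertible, and the defining relations yield
    [N^t C2 N = mu C1] and [N D1 N^t = mu D2], so that [M = mu^(-1/2) N]. *)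
Require Import Defs.
From HB Require Import structures.
From mathcomp Require Import all_boot all_order all_algebra.
From mathcomp Require Import boolp classical_sets.
Import GRing.Theory.
Local Open Scope ring_scope.

Set Implicit Arguments.
Unset Strict Implicit.
Unset Printing Implicit Defensive.

(** * Linear functionals and coinvariants of Galois objects *)

(* Any predicate [S] in the argument may be empty (the union of the empty
   chain), which is why subspaces appear as [S] with [0] adjoined. *)
Lemma exists_dual_vector (k : fieldType) (V : lmodType k) (v : V) : v <> 0 ->
  exists phi : V -> k, linear (phi : V -> k^o) /\ phi v = 1.
Proof.
move=> v0.
pose adj0 (S : set V) a := S a \/ a = 0.
pose P (S : set V) :=
  (forall c a b, adj0 S a -> adj0 S b -> adj0 S (c *: a + b)) /\ ~ S v.
(* By Zorn's lemma, a subspace maximal among those avoiding [v]. It will be the kernel of [phi]. *)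
have [S [[Slin Sv] Smax]] : exists S, P S /\ forall S', (S `<` S')%classic -> ~ P S'.
  apply: Zorn_bigcup => F FP tot; split; last by case=> S FS Sv; case: (FP S FS).
  move=> c a b [[S FS Sa]|->] [[S' FS' Sb]|->].
  - have [S'' FS'' [sa sb]] : exists2 S'', F S'' & S'' a /\ S'' b.
      have [le|le] := tot S S' FS FS'; first by exists S' => //; split=> //; apply: le.
      by exists S => //; split=> //; apply: le.
    case: ((FP _ FS'').1 c a b) => [||h|h]; [by left|by left| |by right].
    by left; exists S''.
  - case: ((FP _ FS).1 c a 0) => [||h|h]; [by left|by right| |by right].
    by left; exists S.
  - by rewrite scaler0 add0r; left; exists S'.
  - by right; rewrite scaler0 addr0.
have S0 : adj0 S 0 by right.
have notv : ~ adj0 S v by case.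
(* Every [z] lies in the line of [v] modulo [S]: otherwise the span [S'] of [S] and [z] would be a
   larger subspace avoiding [v]. The coefficient [c] serves as [phi z]. *)
have ex z : exists c, adj0 S (z - c *: v).
  apply: contrapT => nex.
  pose S' a := exists c w, adj0 S w /\ a = c *: z + w.
  apply: (Smax S'); split.
  - by move=> a Sa; exists 0, a; rewrite scale0r add0r; split=> //; left.
  - move=> le; apply: nex; exists 0; rewrite scale0r subr0; left; apply: le.
    by exists 1, 0; rewrite scale1r addr0.
  - have cl a : adj0 S' a -> S' a.
      by case=> // ->; exists 0, 0; rewrite scale0r addr0.
    move=> c a b /cl [ca [wa [Sa ->]]] /cl [cb [wb [Sb ->]]]; left.
    exists (c * ca + cb), (c *: wa + wb); split; first exact: Slin.
    by rewrite scalerDr scalerDl scalerA addrACA.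
  - case=> c [w [Sw e]]; have [c0|c0] := eqVneq c 0.
      by apply: notv; rewrite e c0 scale0r add0r.
    apply: nex; exists c^-1.
    rewrite e scalerDr scalerA mulVf // scale1r opprD addNKr -scaleNr.
    by rewrite -[_ *: w]addr0; apply: Slin.
have [phi phiP] := choice ex.
have uniq z c : adj0 S (z - c *: v) -> phi z = c.
  move=> h; apply/eqP; rewrite -subr_eq0; apply/negP => /negP ne; apply: notv.
  have := Slin (-1) _ _ (phiP z) h.
  rewrite scaleN1r opprB subrKA -scalerBl => h'.
  have := Slin (phi z - c)^-1 _ _ h' S0.
  by rewrite addr0 scalerA mulVf // scale1r.
exists phi; split; last by apply: uniq; rewrite scale1r subrr.
move=> c a b; apply: uniq.
rewrite scalerDl -scalerA opprD addrACA -scalerBr; exact: Slin.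
Qed.

(** For coinvariant [z] the canonical map sends both [z (x) 1] and [1 (x) z] to [1 (x) z], so by
    injectivity the two agree in [Z (x) Z]. A functional [phi] with [phi 1 = 1], applied to the
    first factor, gives [phi z *: 1 = z]. *)
Lemma galois_coinvariant (k : fieldType) (H : bialgebra k) (Z : comodAlg H) :
  is_galois Z ->
  forall z : Z, coaction z = tpure (1 : H) z -> exists c, z = c *: (1 : Z).
Proof.
move=> [Z1 /bij_inj injZ] z hz.
have bl (w : Z) : bilin (fun (h : H) (y : Z) => pure h (y * w)).
  apply: (tmap_bilin (f := @id H) (g := fun y : Z => y * w)) => //.
  exact: kmul_linl.
have e : pure z (1 : Z) = pure (1 : Z) z.
  apply: injZ; rewrite !galois_map_pure hz.
  have [_ [-> _]] := coaction_morphism Z.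
  by rewrite -tpure1 /tpure !tlift_pure // mul1r mulr1.
have [phi [phil phi1]] := exists_dual_vector Z1.
have bp : bilin (fun a b : Z => phi a *: b).
  split=> [b|a] c x y; first by rewrite phil scalerDl -scalerA.
  by rewrite scalerDr !scalerA mulrC.
have := congr1 (tlift (fun a b : Z => phi a *: b)) e.
by rewrite !tlift_pure // phi1 scale1r => <-; exists (phi z).
Qed.

(** * Scalar matrices over a noncommutative algebra *)

Section ScalarMatrices.
Variables (k : fieldType) (Z : kalg k).

Definition kmx m n (M : 'M[k]_(m, n)) : 'M[Z]_(m, n) :=
  map_mx (fun c : k => c *: (1 : Z)) M.

Lemma kmxM m n p (M : 'M[k]_(m, n)) (N : 'M[k]_(n, p)) :
  kmx (M *m N) = kmx M *m kmx N.
Proof.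
apply/matrixP=> i j; rewrite !mxE scaler_suml; apply: eq_bigr => l _.
by rewrite !mxE -kscalerAl mul1r scalerA.
Qed.

Lemma kmx1 n : kmx 1%:M = 1%:M :> 'M[Z]_n.
Proof.
by apply/matrixP=> i j; rewrite !mxE; case: eqP; rewrite ?scale1r ?scale0r.
Qed.

Lemma kmx_inj m n : (1 : Z) <> 0 -> injective (@kmx m n).
Proof.
move=> Z1 M N /matrixP e; apply/matrixP=> i j; have := e i j; rewrite !mxE.
move=> /eqP; rewrite -subr_eq0 -scalerBl => /eqP h.
apply/eqP; rewrite -subr_eq0; apply/negP => /negP ne; apply: Z1.
by rewrite -[1]scale1r -(mulVf ne) -scalerA h scaler0.
Qed.

Lemma kmxV n (M : 'M[k]_n) : M \in unitmx -> kmx M *m kmx (invmx M) = 1%:M.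
Proof. by move=> hM; rewrite -kmxM mulmxV // kmx1. Qed.
Lemma kVmx n (M : 'M[k]_n) : M \in unitmx -> kmx (invmx M) *m kmx M = 1%:M.
Proof. by move=> hM; rewrite -kmxM mulVmx // kmx1. Qed.

Lemma kmxZ m n a (M : 'M[k]_(m, n)) (z : Z) :
  kmx (a *: M) *m z%:M = kmx M *m (a *: z)%:M.
Proof.
apply/matrixP=> i j; rewrite !mxE; apply: eq_bigr => l _; rewrite !mxE.
case: (_ == _); rewrite ?mulr1n ?mulr0n ?mulr0 //.
by rewrite -!kscalerAl !mul1r scalerA mulrC.
Qed.

Lemma kmx_scalarE m n (M : 'M[k]_(m, n)) (z : Z) i j :
  (kmx M *m z%:M) i j = M i j *: z.
Proof.
rewrite !mxE (bigD1 j) //= big1 => [|l ne].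
  by rewrite !mxE eqxx mulr1n addr0 -kscalerAl mul1r.
by rewrite !mxE (negPf ne) mulr0n mulr0.
Qed.

Lemma kmx_scalarC m n (M : 'M[k]_(m, n)) (z : Z) :
  kmx M *m z%:M = z%:M *m kmx M.
Proof.
apply/matrixP=> i j; rewrite kmx_scalarE !mxE (bigD1 i) //= big1 => [|l ne].
  by rewrite !mxE eqxx mulr1n addr0 -kscalerAr mulr1.
by rewrite !mxE eq_sym (negPf ne) mulr0n mul0r.
Qed.

(** Over a noncommutative ring transposition need not reverse products; it does here because the
    entries of [kmx Z M] are central. *)
Lemma tr_mul_kmx m n p (X : 'M[Z]_(m, n)) (M : 'M[k]_(n, p)) :
  (X *m kmx M)^T = kmx M^T *m X^T.
Proof.
apply/matrixP=> i j; rewrite !mxE; apply: eq_bigr => l _.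
by rewrite !mxE -kscalerAr -kscalerAl mulr1 mul1r.
Qed.

Lemma mul_kmx_mul m n p q (X : 'M[Z]_(m, n)) (M : 'M[k]_(n, p))
    (Y : 'M[Z]_(p, q)) i j :
  (X *m kmx M *m Y) i j = \sum_a \sum_b M a b *: (X i a * Y b j).
Proof.
rewrite !mxE exchange_big /=; apply: eq_bigr => b _; rewrite !mxE mulr_suml.
by apply: eq_bigr => a _; rewrite !mxE -kscalerAr mulr1 -kscalerAl.
Qed.
End ScalarMatrices.

Arguments kmx {k} Z {m n} M.

(** * Algebra maps applied entrywise to matrices *)

Section MatrixMorphisms.
Variables (k : fieldType) (Z Z' : kalg k) (f : Z -> Z').
Hypothesis fm : alg_morphism f.

Lemma map_alg_mxM m n p (X : 'M[Z]_(m, n)) (Y : 'M[Z]_(n, p)) :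
  map_mx f (X *m Y) = map_mx f X *m map_mx f Y.
Proof.
have [fl [_ fM]] := fm; apply/matrixP=> i j; rewrite !mxE (lin_sum fl).
by apply: eq_bigr => l _; rewrite !mxE fM.
Qed.

Lemma map_alg_kmx m n (M : 'M[k]_(m, n)) : map_mx f (kmx Z M) = kmx Z' M.
Proof.
have [fl [f1 _]] := fm.
by apply/matrixP=> i j; rewrite !mxE (linZ fl) f1.
Qed.

Lemma map_alg_scalar_mx n z : map_mx f z%:M = (f z)%:M :> 'M_n.
Proof.
have [fl _] := fm; apply/matrixP=> i j; rewrite !mxE.
by case: (_ == _); rewrite ?mulr0n ?mulr1n ?(lin0 fl).
Qed.

Lemma map_alg_mx1 n : map_mx f 1%:M = 1%:M :> 'M_n.
Proof. by have [_ [f1 _]] := fm; rewrite map_alg_scalar_mx f1. Qed.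
End MatrixMorphisms.

Lemma tpure_morphisml (k : fieldType) (H Z : kalg k) :
  alg_morphism (fun h : H => tpure h (1 : Z)).
Proof.
by split; [exact: tpure_linl|split=> // a b; rewrite tpureM mulr1].
Qed.
Lemma tpure_morphismr (k : fieldType) (H Z : kalg k) :
  alg_morphism (fun z : Z => tpure (1 : H) z).
Proof.
by split; [exact: tpure_linr|split=> // a b; rewrite tpureM mulr1].
Qed.

(** * The generating matrix: relations, invertibility, coaction *)

Section GMatrix.
Variables (k : fieldType) (n m : nat) (A B : 'M[k]_n) (C D : 'M[k]_m).
Local Notation Z := (Galg A B C D).
Local Notation H := (Galg A B A B).
Local Notation d := (Ggd A B C D).
Local Notation di := (Ggdinv A B C D).

Definition Gxmx : 'M[Z]_(n, m) := \matrix_(i, j) Ggx A B C D i j.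
Local Notation X := Gxmx.

Lemma Gxmx_AC : X^T *m kmx Z A *m X = kmx Z C *m d%:M.
Proof.
apply/matrixP=> i j; rewrite mul_kmx_mul kmx_scalarE -GrelAC.
by apply: eq_bigr => p _; apply: eq_bigr => q _; rewrite !mxE.
Qed.

Lemma Gxmx_DB : X *m kmx Z D *m X^T = kmx Z B *m d%:M.
Proof.
apply/matrixP=> i j; rewrite mul_kmx_mul kmx_scalarE -GrelDB.
by apply: eq_bigr => p _; apply: eq_bigr => q _; rewrite !mxE.
Qed.

Lemma Gd_scalarV p : d%:M *m di%:M = 1%:M :> 'M[Z]_p.
Proof. by rewrite -scalar_mxM Grel_ddinv. Qed.
Lemma GV_scalard p : di%:M *m d%:M = 1%:M :> 'M[Z]_p.
Proof. by rewrite -scalar_mxM Grel_dinvd. Qed.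

(** The relation [x^t A x = C d] yields the left inverse [L1] and [x D x^t = B d] the right inverse
    [L2], so the two coincide. The matrix may be rectangular. *)
Lemma Gxmx_invertible : B \in unitmx -> C \in unitmx ->
  exists L : 'M[Z]_(m, n), X *m L = 1%:M /\ L *m X = 1%:M.
Proof.
move=> hB hC.
pose L1 := di%:M *m kmx Z (invmx C) *m X^T *m kmx Z A.
pose L2 := kmx Z D *m X^T *m di%:M *m kmx Z (invmx B).
have e1 : L1 *m X = 1%:M.
  rewrite /L1 -!mulmxA (mulmxA X^T) Gxmx_AC (mulmxA (kmx Z (invmx C))) kVmx //.
  by rewrite mul1mx GV_scalard.
have e2 : X *m L2 = 1%:M.
  rewrite /L2 !mulmxA Gxmx_DB -(mulmxA (kmx Z B)) Gd_scalarV mulmx1.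
  exact: kmxV.
by exists L2; split=> //; rewrite -[L2]mul1mx -e1 -(mulmxA L1) e2 mulmx1.
Qed.

Lemma kmx_dinj p q : (1 : Z) <> 0 ->
  injective (fun M : 'M[k]_(p, q) => kmx Z M *m d%:M).
Proof.
move=> Z1 M N /= /(congr1 (fun Y => Y *m di%:M)).
by rewrite -!mulmxA Gd_scalarV !mulmx1; apply: kmx_inj.
Qed.

(** The coaction in matrix form. The left factor is the same for all [C] and [D], which makes
    generating matrices of different comodule algebras comparable. *)
Lemma coact_Gxmx : map_mx (@Gcoact k n m A B C D) X =
  map_mx (fun h : H => tpure h (1 : Z)) (\matrix_(i, j) Ggx A B A B i j) *m
  map_mx (fun z : Z => tpure (1 : H) z) X.
Proof.
apply/matrixP=> i j; rewrite !mxE Gcoact_x; apply: eq_bigr => l _.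
by rewrite !mxE tpureM mulr1 mul1r.
Qed.
End GMatrix.

(** * Inverses of colinear algebra maps *)

Section ColinearMaps.
Variables (k : fieldType) (H : bialgebra k).

Definition colinear (Z Z' : comodAlg H) (f : Z -> Z') : Prop :=
  forall z, coaction (f z) = tmap id f (coaction z).

Lemma inverse_colinear_morphism (Z Z' : comodAlg H) (f : Z -> Z') (g : Z' -> Z) :
  alg_morphism f -> colinear f -> cancel f g -> cancel g f ->
  alg_morphism g /\ colinear g.
Proof.
move=> [fl [f1 fM]] fc fK gK.
have gl : linear g by move=> c x y; apply: (can_inj fK); rewrite fl !gK.
split; first split=> //.
  split; first by rewrite -f1 fK.
  by move=> x y; apply: (can_inj fK); rewrite fM !gK.
move=> z; rewrite -{2}[z]gK fc.
elim/tens_ind: (coaction (g z)) => [u v|c s t es et].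
  by rewrite !tmap_pure // fK.
by rewrite !tmap_linear // -es -et.
Qed.
End ColinearMaps.

(** * Colinear algebra maps and base change of the generators *)

Section GMaps.
Variables (k : fieldType) (n m1 m2 : nat) (A B : 'M[k]_n).
Variables (C1 D1 : 'M[k]_m1) (C2 D2 : 'M[k]_m2).
Local Notation H := (Galg A B A B).
Local Notation Z1 := (Gcomod A B C1 D1).
Local Notation Z2 := (Gcomod A B C2 D2).
Local Notation X1 := (Gxmx A B C1 D1).
Local Notation X2 := (Gxmx A B C2 D2).
Local Notation d1 := (Ggd A B C1 D1).
Local Notation d2 := (Ggd A B C2 D2).
Local Notation di1 := (Ggdinv A B C1 D1).
Local Notation di2 := (Ggdinv A B C2 D2).

Lemma colinear_on_generators (f : Z1 -> Z2) :
  B \in unitmx -> C2 \in unitmx -> is_galois Z2 ->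
  alg_morphism f -> colinear f ->
  (exists N, map_mx f X1 = X2 *m kmx Z2 N) /\ exists mu, f d1 = mu *: d2.
Proof.
move=> hB hC2 gal fm fc; have [fl _] := fm.
pose io z := tpure (1 : H) (z : Z2).
have iom : alg_morphism io := tpure_morphismr _ _.
have delm : alg_morphism (coaction (c := Z2)) := coaction_morphism Z2.
have [L [XL LX]] := Gxmx_invertible A D2 hB hC2.
split.
  pose W := L *m map_mx f X1.
  have XW : X2 *m W = map_mx f X1 by rewrite mulmxA XL mul1mx.
  have dW : map_mx (coaction (c := Z2)) W = map_mx io W.
    (* Both sides equal the coaction on [f(X1)]: on the right, [X2 W = f(X1)] is recovered inside
       the second tensor factor. The coaction on [X2] then cancels, having the image of [L] as left
       inverse. *)
    have e : map_mx (coaction (c := Z2)) X2 *m map_mx (coaction (c := Z2)) W =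
             map_mx (coaction (c := Z2)) X2 *m map_mx io W.
      rewrite -(map_alg_mxM delm) XW [in RHS]coact_Gxmx -mulmxA.
      rewrite -(map_alg_mxM iom) XW.
      apply/matrixP=> i j; rewrite !mxE fc [coaction _]Gcoact_x.
      rewrite (lin_sum (tmap_linear _ fl)) //; apply: eq_bigr => l _.
      by rewrite !mxE tpureM mulr1 mul1r tmap_pure.
    move/(congr1 (mulmx (map_mx (coaction (c := Z2)) L))): e.
    by rewrite !mulmxA -(map_alg_mxM delm) LX (map_alg_mx1 delm) !mul1mx.
  have ex i j : exists c, W i j = c *: (1 : Z2).
    apply: (galois_coinvariant gal).
    by have /matrixP/(_ i j) := dW; rewrite !mxE.
  exists (\matrix_(i, j) sval (cid (ex i j))); rewrite -XW; congr (_ *m _).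
  apply/matrixP=> i j; by rewrite [RHS]mxE [X in X *: _]mxE; case: cid.
(* The coaction of [di2 * f d1] has first factor [d^-1 d = 1], so this element is coinvariant. *)
have [mu emu] : exists mu, (di2 : Z2) * f d1 = mu *: (1 : Z2).
  apply: (galois_coinvariant gal).
  have [_ [_ ->]] := delm.
  rewrite fc [coaction (d1 : Z1)]Gcoact_d [coaction (di2 : Z2)]Gcoact_dinv.
  rewrite tmap_pure //.
  by rewrite tpureM Grel_dinvd.
exists mu; rewrite -[LHS](mul1r (f d1 : Z2)) -[1](Grel_ddinv A B C2 D2) -mulrA emu.
by rewrite -kscalerAr mulr1.
Qed.

(** The universal property gives [x1 |-> x2 M], [d1 |-> d2], the hypotheses turning the relations of
    [x2] into those of [x1]. It is colinear because the coaction multiplies [x2] on the left and [M]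
    on the right. *)
Lemma base_change_morphism (M : 'M[k]_(m2, m1)) :
  M^T *m C2 *m M = C1 -> M *m D1 *m M^T = D2 ->
  exists f : Z1 -> Z2, [/\ alg_morphism f, colinear f,
    map_mx f X1 = X2 *m kmx Z2 M, f d1 = d2 & f di1 = di2].
Proof.
move=> eC eD; pose Y := X2 *m kmx Z2 M.
have hAC i j : \sum_p \sum_q A p q *: (Y p i * Y q j) = C1 i j *: d2.
  have -> : C1 i j *: d2 = (Y^T *m kmx Z2 A *m Y) i j.
    rewrite /Y tr_mul_kmx !mulmxA -2!(mulmxA (kmx Z2 M^T)) Gxmx_AC.
    by rewrite -!mulmxA -kmx_scalarC !mulmxA -!kmxM eC kmx_scalarE.
  rewrite mul_kmx_mul; apply: eq_bigr => p _; apply: eq_bigr => q _.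
  by rewrite [Y^T i p]mxE.
have hDB i j : \sum_p \sum_q D1 p q *: (Y i p * Y j q) = B i j *: d2.
  have -> : B i j *: d2 = (Y *m kmx Z2 D1 *m Y^T) i j.
    rewrite /Y tr_mul_kmx !mulmxA -2!(mulmxA X2) -!kmxM eD Gxmx_DB.
    by rewrite kmx_scalarE.
  rewrite mul_kmx_mul; apply: eq_bigr => p _; apply: eq_bigr => q _.
  by rewrite [Y^T q j]mxE.
have hr := Grel_ddinv A B C2 D2; have hl := Grel_dinvd A B C2 D2.
pose f : Z1 -> Z2 := Glift (fun i j => Y i j) d2 di2.
have fm : alg_morphism f := Glift_morphism hAC hDB hr hl.
have fl : linear f by case: fm.
have fx i j : f (Ggx A B C1 D1 i j) = Y i j := Glift_x hAC hDB hr hl i j.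
have fd : f d1 = d2 := Glift_d hAC hDB hr hl.
have fdi : f di1 = di2 := Glift_dinv hAC hDB hr hl.
exists f; split=> //; last by apply/matrixP=> i j; rewrite -fx !mxE.
have m2' : alg_morphism (tmap id f : tensA H Z1 -> tensA H Z2).
  exact: tmap_morphism.
have cm := alg_morphism_comp (coaction_morphism Z2) fm.
have cm' := alg_morphism_comp m2' (coaction_morphism Z1).
apply: (Gext cm cm') => [i j||] /=.
- rewrite fx /Y !mxE [in RHS]Gcoact_x.
  have [dl _] := Gcoact_morphism A B C2 D2.
  rewrite (lin_sum dl) (lin_sum (alg_morphism_lin m2')).
  under [RHS]eq_bigr => l _ do rewrite tmap_pure // fx !mxE (lin_sum (pure_linr _)).
  rewrite exchange_big /=; apply: eq_bigr => l _.
  rewrite !mxE -kscalerAr mulr1 (linZ dl) Gcoact_x scaler_sumr.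
  apply: eq_bigr => p _.
  by rewrite !mxE -[in RHS]kscalerAr mulr1 (linZ (pure_linr _)).
- by rewrite fd !Gcoact_d tmap_pure // fd.
- by rewrite fdi !Gcoact_dinv tmap_pure // fdi.
Qed.

(* The relation for [D] only determines [D] after right multiplication by
   [x^t]; multiplying further by [A x] and using the other relation gives
   [C d], which is invertible. *)
Lemma generators_map_relations (f : Z1 -> Z2) (N : 'M[k]_(m2, m1)) (mu : k) :
  B \in unitmx -> C2 \in unitmx -> (1 : Z2) <> 0 ->
  alg_morphism f -> map_mx f X1 = X2 *m kmx Z2 N -> f d1 = mu *: d2 ->
  [/\ mu != 0, N^T *m C2 *m N = mu *: C1 & N *m D1 *m N^T = mu *: D2].
Proof.
move=> hB hC2 Z21 fm fX fd; have [fl [f1 fM]] := fm.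
split.
- apply/eqP => mu0; apply: Z21.
  rewrite -f1 -(Grel_ddinv A B C1 D1) fM fd mu0 scale0r.
  exact: mul0r.
- apply: (@kmx_dinj k n m2 A B C2 D2 _ _ Z21).
  rewrite kmxZ -fd -(map_alg_kmx fm C1) -(map_alg_scalar_mx fm) -(map_alg_mxM fm).
  rewrite -Gxmx_AC !(map_alg_mxM fm) -map_trmx fX tr_mul_kmx (map_alg_kmx fm).
  rewrite !mulmxA -2!(mulmxA (kmx Z2 N^T)) Gxmx_AC.
  by rewrite !kmxM -!mulmxA -kmx_scalarC !mulmxA.
(* Both sides are [B f(d1)]: the left by applying [f] to the relation for [x1], the right by the
   relation for [x2]. *)
- have e : X2 *m kmx Z2 (N *m D1 *m N^T) *m X2^T =
           X2 *m kmx Z2 (mu *: D2) *m X2^T.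
    have -> : X2 *m kmx Z2 (mu *: D2) *m X2^T = kmx Z2 B *m (f d1)%:M.
      apply/matrixP=> i j; rewrite fd -kmxZ kmx_scalarE mul_kmx_mul.
      rewrite [(mu *: B) i j]mxE -scalerA -(GrelDB A B C2 D2) scaler_sumr; apply: eq_bigr => p _.
      rewrite scaler_sumr; apply: eq_bigr => q _.
      by rewrite !mxE scalerA.
    rewrite -(map_alg_kmx fm B) -(map_alg_scalar_mx fm) -(map_alg_mxM fm) -Gxmx_DB.
    rewrite !(map_alg_mxM fm) -map_trmx fX tr_mul_kmx (map_alg_kmx fm).
    by rewrite !kmxM !mulmxA.
  have [L [_ LX]] := Gxmx_invertible A D2 hB hC2.
  move/(congr1 (fun Y => L *m Y *m kmx Z2 A *m X2)): e.
  rewrite !mulmxA LX !mul1mx -2!(mulmxA (kmx _ _)) Gxmx_AC !mulmxA -!kmxM.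
  rewrite -2!(mulmxA (kmx _ _)) Gxmx_AC !mulmxA -!kmxM.
  move/(@kmx_dinj k n m2 A B C2 D2 _ _ Z21)/(congr1 (mulmx^~ (invmx C2))).
  by rewrite !mulmxK.
Qed.
End GMaps.

(** * Classification of the Galois objects by congruence of matrix pairs *)

Theorem theorem5p4 (k : closedFieldType) (n m1 m2 : nat)
    (A B : 'M[k]_n) (lambda : k)
    (C1 D1 : 'M[k]_m1) (C2 D2 : 'M[k]_m2) :
  (2 <= n)%N -> (2 <= m1)%N -> (2 <= m2)%N ->
  A \in unitmx -> B \in unitmx ->
  lambda != 0 -> B^T *m A^T *m B *m A = lambda%:M ->
  C1 \in unitmx -> D1 \in unitmx -> C2 \in unitmx -> D2 \in unitmx ->
  is_galois (Gcomod A B C1 D1) -> is_galois (Gcomod A B C2 D2) ->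
  galois_iso (Gcomod A B C1 D1) (Gcomod A B C2 D2) <->
  exists (e : m1 = m2) (M : 'M[k]_m2),
    [/\ M \in unitmx,
        C2 = (invmx M)^T *m castmx (e, e) C1 *m invmx M &
        D2 = M *m castmx (e, e) D1 *m M^T].
Proof.
move=> _ _ _ _ hB _ _ hC1 hD1 hC2 hD2 gal1 gal2; split.
- case=> f [fm [g fK gK] fc].
  have [gm gc] := inverse_colinear_morphism fm fc fK gK.
  have [[N fX] [mu fd]] := colinear_on_generators hB hC2 gal2 fm fc.
  have [[N' gX] _] := colinear_on_generators hB hC1 gal1 gm gc.
  have [nz1 nz2] := (gal1.1, gal2.1).
  have [mu0 eC eD] := generators_map_relations hB hC2 nz2 fm fX fd.
  (* [X2 N N' = f(X1) N' = f(X1 N') = f(g(X2)) = X2], and [X2] can be cancelled on the left. *)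
  have NN' : N *m N' = 1%:M.
    apply: (kmx_inj nz2).
    have [L [_ LX]] := Gxmx_invertible A D2 hB hC2.
    rewrite kmx1 -LX kmxM -[LHS]mul1mx -{1}LX -!mulmxA; congr (_ *m _).
    rewrite mulmxA -fX -(map_alg_kmx fm) -(map_alg_mxM fm) -gX.
    by apply/matrixP=> i j; rewrite !mxE gK.
  have N'N : N' *m N = 1%:M.
    apply: (kmx_inj nz1).
    have [L [_ LX]] := Gxmx_invertible A D1 hB hC1.
    rewrite kmx1 -LX kmxM -[LHS]mul1mx -{1}LX -!mulmxA; congr (_ *m _).
    rewrite mulmxA -gX -(map_alg_kmx gm) -(map_alg_mxM gm) -fX.
    by apply/matrixP=> i j; rewrite !mxE fK.
  (* Compare ranks over [k] of the mutually inverse, a priori rectangular, [N] and [N']. *)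
  have e : m1 = m2.
    apply/eqP; rewrite eqn_leq; apply/andP; split.
      by rewrite -(mxrank1 k m1) -N'N (leq_trans (mxrankM_maxl _ _)) ?rank_leq_col.
    by rewrite -(mxrank1 k m2) -NN' (leq_trans (mxrankM_maxl _ _)) ?rank_leq_col.
  exists e; subst m2; rewrite !castmx_id.
  have [hN _] := mulmx1_unit NN'.
  (* Algebraic closedness supplies a square root of [mu]. Both relations are quadratic in [N], so
     scaling by [s^-1] removes [mu] from both at once. *)
  have [s es] : exists s : k, s ^+ 2 = mu.
    have [s hs] := solve_monicpoly (fun i => if i == 0%N then mu else 0) (isT : 0 < 2)%N.
    by exists s; rewrite hs big_ord_recl big_ord1 /= mulr1 mul0r addr0.
  have s0 : s != 0 by apply: contraNneq mu0 => s0; rewrite -es s0 expr0n.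
  have ss : s^-1 * s^-1 * mu = 1 by rewrite -invfM -expr2 es mulVf.
  pose M := s^-1 *: N.
  have hM : M \in unitmx by rewrite unitmxZ // unitfE invr_eq0.
  have MT : M^T = s^-1 *: N^T by apply/matrixP=> i j; rewrite !mxE.
  have eC' : M^T *m C2 *m M = C1.
    rewrite MT -!scalemxAl -scalemxAr eC !scalerA.
    by rewrite ss scale1r.
  have eD' : M *m D1 *m M^T = D2.
    rewrite MT /M -scalemxAr -!scalemxAl eD !scalerA.
    by rewrite ss scale1r.
  exists M; split=> //.
  by rewrite -eC' !mulmxA -trmx_mul mulmxV // trmx1 mul1mx mulmxK.
- case=> e [M [hM eC eD]]; subst m2; rewrite !castmx_id in eC eD.
  have eC' : M^T *m C2 *m M = C1.
    by rewrite eC !mulmxA trmx_inv mulmxV ?unitmx_tr // mul1mx mulmxKV.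
  have eDi : invmx M *m D2 *m (invmx M)^T = D1.
    by rewrite eD !mulmxA trmx_inv mulVmx // mul1mx mulmxK ?unitmx_tr.
  (* Base change by [M] and by [invmx M] gives maps in opposite directions; that they are mutually
     inverse is checked on generators. *)
  have [f [fm fc fX fd fdi]] := base_change_morphism A B eC' (esym eD).
  have [g [gm gc gX gd gdi]] := base_change_morphism A B (esym eC) eDi.
  exists f; split=> //; exists g.
    have c1 := alg_morphism_comp gm fm.
    apply: (Gext c1 (alg_morphism_id _)) => [i j||] /=; last 2 first.
    - by rewrite fd gd.
    - by rewrite fdi gdi.
    have : map_mx g (map_mx f (Gxmx A B C1 D1)) = Gxmx A B C1 D1.
      by rewrite fX (map_alg_mxM gm) gX (map_alg_kmx gm) -mulmxA kVmx // mulmx1.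
    by move/matrixP/(_ i j); rewrite !mxE.
  have c1 := alg_morphism_comp fm gm.
  apply: (Gext c1 (alg_morphism_id _)) => [i j||] /=; last 2 first.
  - by rewrite gd fd.
  - by rewrite gdi fdi.
  have : map_mx f (map_mx g (Gxmx A B C2 D2)) = Gxmx A B C2 D2.
    by rewrite gX (map_alg_mxM fm) fX (map_alg_kmx fm) -mulmxA kmxV // mulmx1.
  by move/matrixP/(_ i j); rewrite !mxE.
Qed.
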